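(* Let $f:M\to\mathbb{R}^3$ be a CMC surface ($H=1$, not a round sphere) with Gauss map $N$. Let $\mu=e^{is}\in S^1$, let $\alpha$ be a non-trivial $d^N_\mu$-parallel section, and let $f^\alpha=A^N_{\alpha,s}(f)$ be the CMC surface in the associated family given by $\alpha$. Denote by $A^{S^\alpha}_{\Phi,\lambda}(f^\alpha)$, $\lambda\in S^1$, the associated family of constrained Willmore surfaces of $f^\alpha$, where $S^\alpha$ is the conformal Gauss map of $f^\alpha$. Then, up to Möbius transformation, $$\lim_{\lambda\to1}A^{S^\alpha}_{\Phi,\lambda}(f^\alpha)=A^N_{\alpha,s}(f).$$
   Context: $\mathbb{H}=\mathrm{span}_{\mathbb{R}}\{1,i,j,k\}=\mathbb{R}^4$, $\mathbb{R}^3=\mathrm{Im}\,\mathbb{H}$, $\mathbb{C}=\mathrm{span}_{\mathbb{R}}\{1,i\}$ acting by right multiplication. $M$ is a Riemann surface with universal cover $\tilde M$; $*\omega(X)=\omega(JX)$; $e=\begin{pmatrix}1\\0\end{pmatrix}$. CMC surface: conformal immersion $h:M\to\mathbb{R}^3$ with Gauss map $N_h$ ($*dh=N_h\,dh=-dh\,N_h$), normalized to mean curvature 1, i.e. $dh=-\frac12(dN_h-N_h*dN_h)$. CMC family: $d^{N_h}_\lambda\alpha=d\alpha+\frac12 dh(N_h\alpha(a_\lambda-1)+\alpha b_\lambda)$, $a_\lambda=\frac{\lambda+\lambda^{-1}}2$, $b_\lambda=i\frac{\lambda^{-1}-\lambda}2$, $\lambda\in\mathbb{C}\setminus\{0\}$.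 Associated CMC surface (Sym–Bobenko formula): if $\alpha(t)$ is a smooth family of $d^N_{e^{it}}$-parallel sections near $t=s$ with $\alpha(s)=\alpha$, then $A^N_{\alpha,s}(f)=-2\alpha^{-1}\frac{d}{dt}\alpha(t)|_{t=s}$; it is a CMC surface in $\mathbb{R}^3$ on $\tilde M$ (up to translation) with Gauss map $N^\alpha=\alpha^{-1}N\alpha$. Constrained Willmore family: for a CMC surface $h$ put $\psi_h=\begin{pmatrix}h\\1\end{pmatrix}$, $g_h=h+N_h$. The family of flat connections given by the conformal Gauss map $S_h=F\begin{pmatrix}N_h&0\\1&-N_h\end{pmatrix}F^{-1}$, $F=\begin{pmatrix}1&h\\0&1\end{pmatrix}$, of $h$ is $d^{S_h}_\lambda(e\nu+\psi_h\beta)=d(e\nu+\psi_h\beta)+\frac12\psi_h\,dg_h(-N_h\beta(a_\lambda-1)+\beta b_\lambda)$; for $\lambda\in S^1$ it is quaternionic. For $\lambda\in S^1\setminus\{1\}$, the member $A^{S_h}_{\Phi,\lambda}(h)$ of the associated family of constrained Willmore surfaces is the surface (affine coordinate) with line bundle $\Phi^{-1}(\psi_h\mathbb{H})$, where $\Phi$ is the invertible $\mathbb{H}$-endomorphism whose two columns are a quaternionic basis of $d^{S_h}_\lambda$-parallel sections on $\tilde M$. A different choice of $\Phi$ (for given $\lambda$) changes it by an orientation preserving Möbius transformation, $v\mathbb{H}\mapsto (Bv)\mathbb{H}$ with $B\in\mathrm{GL}(2,\mathbb{H})$. ''Up to Möbius transformation'' means: for suitable choices of $\Phi=\Phi_\lambda$,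 depending on $\lambda$, the limit equals the right-hand side. *)

(* Defs.v *)
From HB Require Import structures.
From mathcomp Require Import all_boot all_order all_algebra.
From mathcomp Require Import ring lra.
From mathcomp Require Import all_classical all_reals all_analysis.

Set Implicit Arguments.
Unset Strict Implicit.
Unset Printing Implicit Defensive.

Import Order.TTheory GRing.Theory Num.Theory.
Import numFieldNormedType.Exports.

Local Open Scope classical_set_scope.
Local Open Scope ring_scope.

(* Quaternions: x + y i + z j + t k is the row (x, y, z, t).  Topology, norm
   (the sup norm) and differential calculus are those of R^4. *)
Definition quat (R : realType) : Type := 'rV[R]_4.

HB.instance Definition _ (R : realType) := NormedModule.copy (quat R) 'rV[R]_4.

Section Quaternion.
Variable R : realType.
Implicit Types x y z : quat R.

Definition qco x (n : nat) : R := (x : 'rV[R]_4) 0 (inord n).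

Definition mkq (a b c d : R) : quat R :=
  \row_(n < 4) nth 0 [:: a; b; c; d] n.

Lemma qco_mkq a b c d :
  (qco (mkq a b c d) 0 = a) * (qco (mkq a b c d) 1 = b) *
  (qco (mkq a b c d) 2 = c) * (qco (mkq a b c d) 3 = d).
Proof. by rewrite /qco !mxE !inordK. Qed.

Lemma quatP x y : qco x 0 = qco y 0 -> qco x 1 = qco y 1 ->
  qco x 2 = qco y 2 -> qco x 3 = qco y 3 -> x = y.
Proof.
move=> h0 h1 h2 h3; apply/rowP => i; rewrite -(inord_val i).
by case: i => [[|[|[|[|]]]]] //= _.
Qed.

Lemma qcoD x y n : qco (x + y) n = qco x n + qco y n.
Proof. by rewrite /qco mxE. Qed.

Lemma qcoZ (r : R) x n : qco (r *: x) n = r * qco x n.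
Proof. by rewrite /qco mxE. Qed.

Lemma qco0 n : qco 0 n = 0.
Proof. by rewrite /qco mxE. Qed.

Definition qone : quat R := mkq 1 0 0 0.

Definition qmul x y : quat R :=
  mkq (qco x 0 * qco y 0 - qco x 1 * qco y 1 - qco x 2 * qco y 2
         - qco x 3 * qco y 3)
      (qco x 0 * qco y 1 + qco x 1 * qco y 0 + qco x 2 * qco y 3
         - qco x 3 * qco y 2)
      (qco x 0 * qco y 2 - qco x 1 * qco y 3 + qco x 2 * qco y 0
         + qco x 3 * qco y 1)
      (qco x 0 * qco y 3 + qco x 1 * qco y 2 - qco x 2 * qco y 1
         + qco x 3 * qco y 0).

Lemma qmulA : associative qmul.
Proof. by move=> x y z; apply: quatP; rewrite !qco_mkq; ring. Qed.

Lemma qmul1q : left_id qone qmul.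
Proof. by move=> x; apply: quatP; rewrite !qco_mkq; ring. Qed.

Lemma qmulq1 : right_id qone qmul.
Proof. by move=> x; apply: quatP; rewrite !qco_mkq; ring. Qed.

Lemma qmulDl : left_distributive qmul +%R.
Proof. by move=> x y z; apply: quatP; rewrite !(qco_mkq, qcoD); ring. Qed.

Lemma qmulDr : right_distributive qmul +%R.
Proof. by move=> x y z; apply: quatP; rewrite !(qco_mkq, qcoD); ring. Qed.

Lemma qone_neq0 : qone != 0.
Proof.
apply/eqP => /(congr1 (qco^~ 0%N)) /eqP.
by rewrite qco_mkq qco0 oner_eq0.
Qed.

HB.instance Definition _ := GRing.Zmodule_isNzRing.Build (quat R)
  qmulA qmul1q qmulq1 qmulDl qmulDr qone_neq0.

Lemma qscaleAl (r : R) x y : r *: (x * y) = (r *: x) * y.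
Proof. by apply: quatP; rewrite !(qco_mkq, qcoZ); ring. Qed.

HB.instance Definition _ := GRing.Lmodule_isLalgebra.Build R (quat R) qscaleAl.

Definition qconj x : quat R := mkq (qco x 0) (- qco x 1) (- qco x 2) (- qco x 3).

(* The square of the Euclidean norm. *)
Definition qnorm2 x : R :=
  qco x 0 ^+ 2 + qco x 1 ^+ 2 + qco x 2 ^+ 2 + qco x 3 ^+ 2.

Definition qinv x : quat R := (qnorm2 x)^-1 *: qconj x.

Lemma qnorm2_eq0 x : (qnorm2 x == 0) = (x == 0).
Proof.
apply/eqP/eqP => [|->]; last by rewrite /qnorm2 !qco0; ring.
rewrite /qnorm2 => h.
have h0 := sqr_ge0 (qco x 0); have h1 := sqr_ge0 (qco x 1).
have h2 := sqr_ge0 (qco x 2); have h3 := sqr_ge0 (qco x 3).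
by apply: quatP; rewrite qco0; apply/eqP; rewrite -sqrf_eq0; apply/eqP; lra.
Qed.

Lemma qmulVq : {in [pred x | x != 0], left_inverse 1 qinv *%R}.
Proof.
move=> x; rewrite inE -qnorm2_eq0 => x0.
apply: quatP; rewrite !(qco_mkq, qcoZ); rewrite /qnorm2 in x0 *; field => //.
Qed.

Lemma qmulqV : {in [pred x | x != 0], right_inverse 1 qinv *%R}.
Proof.
move=> x; rewrite inE -qnorm2_eq0 => x0.
apply: quatP; rewrite !(qco_mkq, qcoZ); rewrite /qnorm2 in x0 *; field => //.
Qed.

Lemma qunitP x y : y * x = 1 /\ x * y = 1 -> x \in [pred x | x != 0].
Proof.
move=> [yx _]; rewrite inE; apply/eqP => x0; move: yx.
by rewrite x0 mulr0 => /esym/eqP; rewrite oner_eq0.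
Qed.

Lemma qinv_out : {in [predC [pred x : quat R | x != 0]], qinv =1 id}.
Proof.
move=> x; rewrite !inE negbK => /eqP ->.
by apply: quatP; rewrite !(qcoZ, qco_mkq, qco0) ?oppr0 mulr0.
Qed.

HB.instance Definition _ := GRing.NzRing_hasMulInverse.Build (quat R)
  qmulVq qmulqV qunitP qinv_out.

End Quaternion.

Section QuaternionSubsets.
Variable R : realType.

Definition imH : set (quat R) := [set x | qco x 0 = 0].

Definition qi : quat R := mkq 0 1 0 0.

Definition qexpi (t : R) : quat R := mkq (cos t) (sin t) 0 0.

(* S^1 inside C = span{1, i}, itself inside the quaternions. *)
Definition unit_circle : set (quat R) :=
  [set l | [/\ qco l 2 = 0, qco l 3 = 0 & qnorm2 l = 1]].

Definition unit_sphere : set (quat R) := imH `&` [set x | qnorm2 x = 1].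

(* The filter "lambda tends to 1 in S^1 minus 1". *)
Definition circle_to_1 : set_system (quat R) :=
  within (unit_circle `\ 1) (nbhs (1 : quat R)).

(* a_lambda and b_lambda, for a quaternion lambda in C minus 0. *)
Definition acoef (l : quat R) : quat R := 2^-1 *: (l + l^-1).
Definition bcoef (l : quat R) : quat R := 2^-1 *: (qi * (l^-1 - l)).

End QuaternionSubsets.

Arguments circle_to_1 R : clear implicits.

Section Calculus.
Variable R : realType.

Fixpoint Ck_on (V W : normedModType R) (k : nat) (U : set V) (f : V -> W)
    : Prop :=
  if k is k'.+1 then
    (forall x, U x -> differentiable f x) /\
    (forall v : V, Ck_on k' U (fun x => 'D_v f x))
  else forall x, U x -> {for x, continuous f}.

Definition smooth_on (V W : normedModType R) (U : set V) (f : V -> W) : Prop :=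
  forall k, Ck_on k U f.

(* The complex plane is R * R, (x, y) standing for x + i y. *)
Definition rotJ (X : R * R) : R * R := (- X.2, X.1).

Definition holomorphic_on (U : set (R * R)) (phi : R * R -> R * R) : Prop :=
  forall z, U z -> differentiable phi z /\
    forall X, 'd phi z (rotJ X) = rotJ ('d phi z X).

End Calculus.

Section RiemannSurface.
Variables (R : realType).

(* [cinv] is only meaningful on the image of [cdom] under [cmap]. *)
Record chart (T : Type) := Chart {
  cdom : set T ;
  cmap : T -> R * R ;
  cinv : R * R -> T }.

Definition cimg (T : Type) (u : chart T) : set (R * R) := cmap u @` cdom u.

Definition is_chart (T : topologicalType) (u : chart T) : Prop :=
  [/\ open (cdom u), open (cimg u),
      (forall p, cdom u p -> cinv u (cmap u p) = p),
      (forall p, cdom u p -> {for p, continuous (cmap u)}) &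
      (forall z, cimg u z -> {for z, continuous (cinv u)})].

Definition holomorphic_map (S T : Type) (atS : set (chart S))
    (atT : set (chart T)) (f : S -> T) : Prop :=
  forall u v, atS u -> atT v ->
    holomorphic_on (cmap u @` (cdom u `&` f @^-1` cdom v))
      (cmap v \o f \o cinv u).

(* Second countability is automatic, by Rado's theorem. *)
Record riemann_surface (T : topologicalType) (at_ : set (chart T)) : Prop := {
  rs_hausdorff : hausdorff_space T ;
  rs_connected : connected [set: T] ;
  rs_chart : forall u, at_ u -> is_chart u ;
  rs_cover : forall p, exists2 u, at_ u & cdom u p ;
  rs_compat : holomorphic_map at_ at_ id }.

Definition covering_map (S T : topologicalType) (pi : S -> T) : Prop :=
  [/\ continuous pi, range pi = [set: T] &
      forall q, exists (U : set T) (I : Type) (V : I -> set S),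
        [/\ open U, U q, trivIset [set: I] V,
            \bigcup_i V i = pi @^-1` U &
            forall i, [/\ open (V i), set_bij (V i) U pi &
              forall W, open W -> W `<=` V i -> open (pi @` W)]]].

(* Every loop is contractible relative to its base point. *)
Definition simply_connected (T : topologicalType) : Prop :=
  forall gamma : R -> T, {within `[0, 1], continuous gamma} ->
    gamma 0 = gamma 1 ->
    exists H : R * R -> T,
      [/\ {within `[0, 1] `*` `[0, 1], continuous H},
          (forall x, x \in `[0, 1] -> H (x, 0) = gamma x),
          (forall x, x \in `[0, 1] -> H (x, 1) = gamma 0) &
          (forall y, y \in `[0, 1] -> H (0, y) = gamma 0 /\ H (1, y) = gamma 0)].

Definition universal_cover (S T : topologicalType) (atS : set (chart S))
    (atT : set (chart T)) (pi : S -> T) : Prop :=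
  [/\ riemann_surface atS, simply_connected S, covering_map pi &
      holomorphic_map atS atT pi].

Section Surfaces.
Variables (T : topologicalType) (at_ : set (chart T)).

Definition smooth_map (h : T -> quat R) : Prop :=
  forall u, at_ u -> smooth_on (cimg u) (h \o cinv u).

(* The 1-form dh, in the chart u: at the point of coordinate z, on the tangent
   vector of coordinates X.  Charts being holomorphic, the complex structure J
   is [rotJ] in coordinates and * omega (X) = omega (rotJ X). *)
Definition dform (u : chart T) (h : T -> quat R) (z X : R * R) : quat R :=
  'D_X (h \o cinv u) z.

Definition on_tangents (P : chart T -> R * R -> R * R -> Prop) : Prop :=
  forall u z X, at_ u -> cimg u z -> P u z X.

Definition immersion (h : T -> quat R) : Prop :=
  on_tangents (fun u z X => X != 0 -> dform u h z X != 0).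

(* h is conformal with Gauss map N: * dh = N dh = - dh N. *)
Definition gauss_map (h N : T -> quat R) : Prop :=
  [/\ smooth_map N, (forall p, unit_sphere (N p)) &
      on_tangents (fun u z X =>
        dform u h z (rotJ X) = N (cinv u z) * dform u h z X /\
        dform u h z (rotJ X) = - (dform u h z X * N (cinv u z)))].

Definition mean_curvature_1 (h N : T -> quat R) : Prop :=
  on_tangents (fun u z X =>
    dform u h z X =
      - (2^-1 *: (dform u N z X - N (cinv u z) * dform u N z (rotJ X)))).

Definition cmc_surface (h N : T -> quat R) : Prop :=
  [/\ smooth_map h, (forall p, imH (h p)), immersion h, gauss_map h N &
      mean_curvature_1 h N].

Definition in_round_sphere (h : T -> quat R) : Prop :=
  exists2 c : quat R, imH c & exists r : R, forall p, qnorm2 (h p - c) = r.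

Definition cmc_conn (h N : T -> quat R) (l : quat R) (alpha : T -> quat R)
    (u : chart T) (z X : R * R) : quat R :=
  let p := cinv u z in
  dform u alpha z X +
    2^-1 *: (dform u h z X *
      (N p * alpha p * (acoef l - 1) + alpha p * bcoef l)).

Definition cmc_parallel (h N : T -> quat R) (l : quat R)
    (alpha : T -> quat R) : Prop :=
  smooth_map alpha /\
  on_tangents (fun u z X => cmc_conn h N l alpha u z X = 0).

(* A family alpha t of parallel sections for lambda = e^{it}, defined for t
   near s and smooth in t and the point jointly. *)
Definition parallel_family (h N : T -> quat R) (s : R)
    (alpha : R -> T -> quat R) : Prop :=
  exists2 eps : R, 0 < eps &
    (forall u, at_ u ->
      smooth_on (`]s - eps, s + eps[ `*` cimg u)
        (fun tz : R * (R * R) => alpha tz.1 (cinv u tz.2))) /\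
    (forall t, t \in `]s - eps, s + eps[ ->
      cmc_parallel h N (qexpi t) (alpha t)).

Definition sym_bobenko (s : R) (alpha : R -> T -> quat R) (p : T) : quat R :=
  - 2 *: ((alpha s p)^-1 * derive1 (fun t => alpha t p) s).

Definition sym_bobenko_gauss (N alpha : T -> quat R) (p : T) : quat R :=
  (alpha p)^-1 * N p * alpha p.

(* Sections of the trivial H^2 bundle; H acts on the right, so that
   multiplication of a column by the quaternion q is [v *m q%:M]. *)
Definition colq (x y : quat R) : 'cV[quat R]_2 :=
  \col_(i < 2) (if i == 0 then x else y).

Definition psi (h : T -> quat R) (p : T) : 'cV[quat R]_2 := colq (h p) 1.

Definition qline (v : 'cV[quat R]_2) : set 'cV[quat R]_2 :=
  [set v *m (q%:M : 'M[quat R]_1) | q in [set: quat R]].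

(* The connection of the conformal Gauss map of h; in v = e nu + psi beta the
   coefficient beta is the second entry of v. *)
Definition cw_conn (h N : T -> quat R) (l : quat R) (v : T -> 'cV[quat R]_2)
    (u : chart T) (z X : R * R) : 'cV[quat R]_2 :=
  let p := cinv u z in
  let beta := v p 1 0 in
  let g := fun p' => h p' + N p' in
  \col_i dform u (fun p' => v p' i 0) z X +
    psi h p *m (2^-1 *: (dform u g z X *
      (- (N p * beta * (acoef l - 1)) + beta * bcoef l)))%:M.

Definition cw_parallel (h N : T -> quat R) (l : quat R)
    (v : T -> 'cV[quat R]_2) : Prop :=
  (forall i, smooth_map (fun p => v p i 0)) /\
  on_tangents (fun u z X => cw_conn h N l v u z X = 0).

Definition mx_invertible (B : 'M[quat R]_2) : Prop :=
  exists C, B *m C = 1%:M /\ C *m B = 1%:M.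

Definition parallel_frame (h N : T -> quat R) (l : quat R)
    (Phi : T -> 'M[quat R]_2) : Prop :=
  (forall p, mx_invertible (Phi p)) /\
  (forall j, cw_parallel h N l (fun p => col j (Phi p))).

(* A is the affine coordinate of the line bundle Phi^{-1} (psi_h H). *)
Definition cw_associated (h N : T -> quat R) (l : quat R)
    (Phi : T -> 'M[quat R]_2) (A : T -> quat R) : Prop :=
  parallel_frame h N l Phi /\
  forall p, mulmx (Phi p) @^-1` qline (psi h p) = qline (colq (A p) 1).

End Surfaces.
End RiemannSurface.

(* Main.v *)
(* Write c = cos s, sg = sin s, and let P = alpha^-1.  For lambda = e^{i tau}
   the numbers a_lambda and b_lambda are real, and in terms of
   K(t) = N (cos t - 1) + sin t parallel sections satisfy
   d alpha(t) = - (1/2) dh K(t) alpha(t).  This gives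
     d f^alpha = P dh (c - N sg) alpha,
     d (f^alpha + N^alpha) = P d(h + N) alpha,
   and alpha' = P alpha(s + tau) is parallel for f^alpha and e^{i tau}.  If
   alpha' is parallel then beta = N^alpha alpha' (cos tau - 1) + alpha' sin tau
   satisfies d alpha' = - (1/2) d f^alpha beta, and e (2 alpha') + psi beta is
   a parallel section of the constrained Willmore connection; so is the
   constant section e.  Hence the columns e and
   e (2 (alpha' - 1) / tau) + psi (beta / tau) form a parallel frame, for which
   the associated constrained Willmore surface has affine coordinate
     - 2 (alpha' - 1) / tau = - 2 alpha^-1 (alpha(s + tau) - alpha(s)) / tau.
   This is a difference quotient whose limit is the Sym-Bobenko formula. *)

Require Import Defs.
From HB Require Import structures.
From mathcomp Require Import all_boot all_order all_algebra.
From mathcomp Require Import ring lra.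
From mathcomp Require Import all_classical all_reals all_analysis.
Import Order.TTheory GRing.Theory Num.Theory.
Import numFieldNormedType.Exports.
Local Open Scope classical_set_scope.
Local Open Scope ring_scope.

Set Implicit Arguments.
Unset Strict Implicit.
Unset Printing Implicit Defensive.

(** * Functions of class C^k *)

Section Ck.
Variable R : realType.
Implicit Types (U V W : normedModType R) (k : nat).

(** As tau tends to 0, alpha' tends to 1 and beta to 0: the frame with columns e and e (2 alpha') +
    psi beta degenerates, and its surface -2 alpha' collapses to the point -2. Subtracting 2e from
    the second column and dividing by tau is a constant change of basis, hence a Möbius
    transformation depending on lambda; it blows the collapsing family up to a difference quotient.
    Two obstacles shape the rest. The frame must be smooth and beta contains [N \o pi], while a
    holomorphic map such as pi is only assumed once complex differentiable. Smoothness is recovered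
    from the given parallel sections: their equations express d(f o pi) through smooth data, and the
    conformality of f then upgrades pi in charts. Moreover alpha^-1 must exist on the whole cover:
    for lambda on the unit circle a parallel section has constant norm, so it has no zeros and its
    inverse is a constant multiple of its conjugate. The formula for d f^alpha interchanges the
    derivative in t with those along the surface, whence the symmetry of second derivatives. *)

Lemma Ck_on_sub V W k (A B : set V) (f : V -> W) :
  A `<=` B -> Ck_on k B f -> Ck_on k A f.
Proof.
elim: k f => [|k IHk] f AB /=; first by move=> h x /AB; exact: h.
by move=> [df Df]; split=> [x /AB|v]; [exact: df|exact: IHk].
Qed.

Lemma Ck_on_local V W k (A : set V) (f : V -> W) :
  (forall x, A x -> exists2 B : set V, B x & Ck_on k B f) -> Ck_on k A f.
Proof.
elim: k f => [|k IHk] f h /=; first by move=> x /h[B Bx]; exact.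
split=> [x /h[B Bx [df _]]|v]; first exact: (df _ Bx).
by apply: IHk => x /h[B Bx [_ Df]]; exists B => //; exact: Df.
Qed.

Lemma near_eq_differentiable V W (f g : V -> W) x :
  (\forall y \near x, f y = g y) -> differentiable f x -> differentiable g x.
Proof.
move=> fg df; have fgx : f x = g x by exact: (nbhs_singleton fg).
have fgh : \forall h \near 0, f (h + x) = g (h + x).
  by move: fg; rewrite (near_shift 0) /= subr0.
have dg : g \o shift x = cst (g x) + 'd f x +o_ 0 id.
  apply/eqaddoP => e e0; have /eqaddoP /(_ e e0) := diff_locally df.
  apply: filter_app; near=> h.
  suff -> : (g \o shift x - (cst (g x) + 'd f x)) h =
            (f \o shift x - (cst (f x) + 'd f x)) h by [].
  have e1 : f (h + x) = g (h + x) by near: h.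
  by rewrite -[LHS]/(g (h + x) - (g x + 'd f x h)) -e1 -fgx.
have dfc := diff_continuous df.
by apply/diff_locallyP; rewrite (diff_unique dfc dg).
Unshelve. all: by end_near. Qed.

(** Openness matters because [Ck_on] uses derivatives of the ambient space: agreement on an open set
    passes to all of them. Every closure property below reduces to an inductive case through this
    lemma. *)
Lemma Ck_on_eq V W k (A : set V) (f g : V -> W) : open A ->
  (forall x, A x -> f x = g x) -> Ck_on k A f -> Ck_on k A g.
Proof.
move=> oA; have nA x : A x -> \forall y \near x, A y.
  by move=> Ax; apply: open_nbhs_nbhs.
elim: k f g => [|k IHk] f g fg /=.
  move=> cf x Ax; have : {near x, f =1 g} by apply: filterS (nA x Ax) => y /fg.
  by move=> fgx; apply: cvg_trans (near_eq_cvg fgx) _; rewrite -fg //; exact: cf.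
move=> [df Df]; have fgn x : A x -> \forall y \near x, f y = g y.
  by move=> Ax; apply: filterS (nA x Ax) => y /fg.
split=> [x Ax|v]; first exact: near_eq_differentiable (fgn x Ax) (df x Ax).
by apply: IHk (Df v) => x Ax; apply/near_eq_derive/fgn.
Qed.

Lemma Ck_onS V W k (A : set V) (f : V -> W) : Ck_on k.+1 A f -> Ck_on k A f.
Proof.
elim: k f => [|k IHk] f /= [df Df].
  by move=> x /df; exact: differentiable_continuous.
by split=> [//|v]; apply: IHk; exact: Df.
Qed.

Lemma smooth_on_differentiable V W (A : set V) (f : V -> W) x :
  smooth_on A f -> A x -> differentiable f x.
Proof. by move=> /(_ 1%N)[+ _]; exact. Qed.

Lemma smooth_on_continuous V W (A : set V) (f : V -> W) x :
  smooth_on A f -> A x -> {for x, continuous f}.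
Proof. by move=> /(_ 0%N); exact. Qed.

Lemma smooth_on_derive V W (A : set V) (f : V -> W) v :
  smooth_on A f -> smooth_on A ('D_v f).
Proof. by move=> sf k; have [_ /(_ v)] := sf k.+1. Qed.

Lemma Ck_on_cst V W k (A : set V) (c : W) : Ck_on k A (fun=> c).
Proof.
elim: k c => [|k IHk] c /=; first by move=> x _; exact: cst_continuous.
split=> [x _|v]; first exact: differentiable_cst.
have -> : 'D_v (fun=> c) = (fun=> 0) :> (V -> W).
  by apply/funext => x; exact: derive_cst.
exact: IHk.
Qed.

Lemma Ck_onD V W k (A : set V) (f g : V -> W) : open A ->
  Ck_on k A f -> Ck_on k A g -> Ck_on k A (fun x => f x + g x).
Proof.
move=> oA; elim: k f g => [|k IHk] f g /=.
  by move=> cf cg x Ax; apply: continuousD; [exact: cf|exact: cg].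
move=> [df Df] [dg Dg]; split=> [x Ax|v].
  by apply: differentiableD; [exact: df|exact: dg].
apply: Ck_on_eq (IHk _ _ (Df v) (Dg v)) => // x Ax.
by rewrite -deriveD //; apply: diff_derivable; [exact: df|exact: dg].
Qed.

Lemma differentiable_linear V W W' (L : {linear W -> W'}) (f : V -> W) x :
  continuous L -> differentiable f x -> differentiable (fun y => L (f y)) x.
Proof.
move=> cL df; apply: (differentiable_comp df).
exact: linear_differentiable.
Qed.

Lemma derive_linear V W W' (L : {linear W -> W'}) (f : V -> W) x v :
  continuous L -> differentiable f x ->
  'D_v (fun y => L (f y)) x = L ('D_v f x).
Proof.
move=> cL df; rewrite !deriveE //; last exact: differentiable_linear.
have dL := linear_differentiable (f x) cL.
have -> : 'd (fun y => L (f y)) x = 'd L (f x) \o 'd f x :> (_ -> _).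
  exact: (diff_comp df dL).
by rewrite /= diff_lin.
Qed.

Lemma Ck_on_linear V W W' k (A : set V) (L : {linear W -> W'}) (f : V -> W) :
  open A -> continuous L -> Ck_on k A f -> Ck_on k A (fun x => L (f x)).
Proof.
move=> oA cL; elim: k f => [|k IHk] f /=.
  by move=> cf x Ax; apply: continuous_comp; [exact: cf|exact: cL].
move=> [df Df]; split=> [x Ax|v].
  by apply: differentiable_linear => //; exact: df.
apply: Ck_on_eq (IHk _ (Df v)) => // x Ax.
by rewrite derive_linear //; exact: df.
Qed.

Section Bilinear.
Variables (W1 W2 W3 : normedModType R) (B : {bilinear W1 -> W2 -> W3}).
Hypothesis cB : continuous (fun p : W1 * W2 => B p.1 p.2).

Lemma differentiable_bilinear V (f : V -> W1) (g : V -> W2) x :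
  differentiable f x -> differentiable g x ->
  differentiable (fun y => B (f y) (g y)) x.
Proof.
move=> df dg; have dB := differentiable_bilin (f x, g x) cB.
exact: (differentiable_comp (differentiable_pair df dg) dB).
Qed.

Lemma derive_bilinear V (f : V -> W1) (g : V -> W2) x v :
  differentiable f x -> differentiable g x ->
  'D_v (fun y => B (f y) (g y)) x = B ('D_v f x) (g x) + B (f x) ('D_v g x).
Proof.
move=> df dg; rewrite !deriveE //; last exact: differentiable_bilinear.
have dp := differentiable_pair df dg.
have dB := differentiable_bilin (f x, g x) cB.
have -> : 'd (fun y => B (f y) (g y)) x =
    'd (fun p : W1 * W2 => B p.1 p.2) (f x, g x) \o
    'd (fun y => (f y, g y)) x :> (_ -> _) by exact: (diff_comp dp dB).
by rewrite /= (diff_bilin _ cB) (diff_pair df dg) /= addrC.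
Qed.

(** Induction through the Leibniz rule, each summand pairing one derivative with one factor lowered
    by [Ck_onS]. Quaternion products and scalings are both instances. *)
Lemma Ck_on_bilinear V k (A : set V) (f : V -> W1) (g : V -> W2) : open A ->
  Ck_on k A f -> Ck_on k A g -> Ck_on k A (fun x => B (f x) (g x)).
Proof.
move=> oA; elim: k f g => [|k IHk] f g.
  move=> /= cf cg x Ax.
  have cfg : {for x, continuous (fun x => (f x, g x))}.
    by apply: cvg_pair; [exact: cf|exact: cg].
  exact: (@continuous_comp _ _ _ _ (fun p => B p.1 p.2) x cfg (@cB _)).
move=> Cf Cg; have [df Df] := Cf; have [dg Dg] := Cg; split=> [x Ax|v].
  by apply: differentiable_bilinear; [exact: df|exact: dg].
have C := Ck_onD oA (IHk _ _ (Df v) (Ck_onS Cg)) (IHk _ _ (Ck_onS Cf) (Dg v)).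
apply: Ck_on_eq C => // x Ax.
by rewrite derive_bilinear //; [exact: df|exact: dg].
Qed.

End Bilinear.
End Ck.

(** * Quaternion-valued functions *)

Section QuaternionCalculus.
Variable R : realType.
Implicit Types (x y z : quat R) (V : normedModType R).

Lemma qcoN x n : qco (- x) n = - qco x n.
Proof. by rewrite /qco mxE. Qed.

Lemma qcoM x y : (qco (x * y) 0 = qco x 0 * qco y 0 - qco x 1 * qco y 1
         - qco x 2 * qco y 2 - qco x 3 * qco y 3) *
  (qco (x * y) 1 = qco x 0 * qco y 1 + qco x 1 * qco y 0 + qco x 2 * qco y 3
         - qco x 3 * qco y 2) *
  (qco (x * y) 2 = qco x 0 * qco y 2 - qco x 1 * qco y 3 + qco x 2 * qco y 0
         + qco x 3 * qco y 1) *
  (qco (x * y) 3 = qco x 0 * qco y 3 + qco x 1 * qco y 2 - qco x 2 * qco y 1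
         + qco x 3 * qco y 0).
Proof. by do !split; rewrite qco_mkq. Qed.

Lemma qco1 : (qco (1 : quat R) 0 = 1) * (qco (1 : quat R) 1 = 0) *
  (qco (1 : quat R) 2 = 0) * (qco (1 : quat R) 3 = 0).
Proof. by do !split; rewrite qco_mkq. Qed.

Lemma qco_conj x : (qco (qconj x) 0 = qco x 0) * (qco (qconj x) 1 = - qco x 1) *
  (qco (qconj x) 2 = - qco x 2) * (qco (qconj x) 3 = - qco x 3).
Proof. by do !split; rewrite qco_mkq. Qed.

Definition qsimp := (qcoM, qco_conj, qcoD, qcoN, qcoZ, qco0, qco1).

Lemma qscaleAr (r : R) x y : r *: (x * y) = x * (r *: y).
Proof. by apply: quatP; rewrite !qsimp; ring. Qed.

Lemma qmul_is_bilinear : bilinear_for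
  (GRing.Scale.Law.clone _ _ *:%R _) (GRing.Scale.Law.clone _ _ *:%R _)
  (@qmul R).
Proof.
split=> [y|x] a u v /=.
  by rewrite -[LHS]/((a *: u + v) * y) mulrDl scalerAl.
by rewrite -[LHS]/(x * (a *: u + v)) mulrDr qscaleAr.
Qed.
HB.instance Definition _ := bilinear_isBilinear.Build R (quat R) (quat R)
  (quat R) _ _ (@qmul R) qmul_is_bilinear.

Lemma qconj_is_linear : linear (@qconj R).
Proof. by move=> a x y; apply: quatP; rewrite !qsimp; ring. Qed.
HB.instance Definition _ :=
  GRing.isLinear.Build R (quat R) (quat R) _ (@qconj R) qconj_is_linear.

Definition qcoord (n : nat) x : R := qco x n.
Lemma qcoord_is_linear n : linear (qcoord n : quat R -> R^o).
Proof. by move=> a x y; rewrite /qcoord !qsimp. Qed.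
HB.instance Definition _ n :=
  GRing.isLinear.Build R (quat R) R^o _ (qcoord n) (@qcoord_is_linear n).

(** A named form of scaling, with scalars in [R^o], to which a bilinear structure can be
    attached. *)
Definition rscale (W : normedModType R) (r : R^o) (w : W) : W := r *: w.

Lemma scale_is_bilinear (W : normedModType R) : bilinear_for
  (GRing.Scale.Law.clone _ _ *:%R _) (GRing.Scale.Law.clone _ _ *:%R _)
  (@rscale W).
Proof.
rewrite /rscale; split=> [y|x] a u v /=; first by rewrite scalerDl scalerA.
by rewrite scalerDr !scalerA mulrC.
Qed.
HB.instance Definition _ (W : normedModType R) :=
  bilinear_isBilinear.Build R R^o W W _ _ (@rscale W)
  (@scale_is_bilinear W).

Lemma qcoord_continuous n : continuous (qcoord n).
Proof. exact: coord_continuous. Qed.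

Lemma mkq_continuous (T : topologicalType) (a b c0 d : T -> R) p :
  {for p, continuous a} -> {for p, continuous b} ->
  {for p, continuous c0} -> {for p, continuous d} ->
  {for p, continuous (fun q => mkq (a q) (b q) (c0 q) (d q))}.
Proof.
move=> ca cb cc cd.
have -> : (fun q => mkq (a q) (b q) (c0 q) (d q)) =
  (fun q => a q *: (1 : quat R) + b q *: mkq 0 1 0 0 + c0 q *: mkq 0 0 1 0
     + d q *: mkq 0 0 0 1 : quat R).
  by apply/funext => q; apply: quatP; rewrite !(qsimp, qco_mkq); ring.
have c (a' : T -> R) (u : quat R) : {for p, continuous a'} ->
    {for p, continuous (fun q => a' q *: u)} by exact: continuousZr_tmp.
exact: (continuousD (continuousD (continuousD (c a _ ca) (c b _ cb)) (c c0 _ cc))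
  (c d _ cd)).
Qed.

Lemma qmul_continuous : continuous (fun p : quat R * quat R => p.1 * p.2).
Proof.
move=> p.
have c1 n : {for p, continuous (fun q : quat R * quat R => qco q.1 n)}.
  apply: (@continuous_comp _ _ _ fst (@qcoord n)); first exact: cvg_fst.
  exact: qcoord_continuous.
have c2 n : {for p, continuous (fun q : quat R * quat R => qco q.2 n)}.
  apply: (@continuous_comp _ _ _ snd (@qcoord n)); first exact: cvg_snd.
  exact: qcoord_continuous.
have cM m n : {for p, continuous (fun q => qco q.1 m * qco q.2 n)}.
  exact: (continuousM (c1 m) (c2 n)).
suff : {for p, continuous (fun q : quat R * quat R => qmul q.1 q.2)} by [].
exact: (mkq_continuous
  (continuousB (continuousB (continuousB (cM 0%N 0%N) (cM 1%N 1%N)) (cM 2%N 2%N))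
     (cM 3%N 3%N))
  (continuousB (continuousD (continuousD (cM 0%N 1%N) (cM 1%N 0%N)) (cM 2%N 3%N))
     (cM 3%N 2%N))
  (continuousD (continuousD (continuousB (cM 0%N 2%N) (cM 1%N 3%N)) (cM 2%N 0%N))
     (cM 3%N 1%N))
  (continuousD (continuousB (continuousD (cM 0%N 3%N) (cM 1%N 2%N)) (cM 2%N 1%N))
     (cM 3%N 0%N))).
Qed.

Lemma qconj_continuous : continuous (@qconj R).
Proof.
move=> p.
have cq n : {for p, continuous (fun q : quat R => qco q n)}.
  exact: qcoord_continuous.
suff : {for p, continuous (fun q : quat R => mkq (qco q 0) (- qco q 1)
                                                 (- qco q 2) (- qco q 3))} by [].
by apply: mkq_continuous; do ?apply: continuousN; apply: cq.
Qed.

Lemma qscale_continuous (W : normedModType R) :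
  continuous (fun p : R^o * W => p.1 *: p.2).
Proof. exact: scale_continuous. Qed.

Definition qmulB : {bilinear quat R -> quat R -> quat R} := @qmul R.
Definition qscaleB (W : normedModType R) : {bilinear R^o -> W -> W} :=
  @rscale W.
Definition qconjL : {linear quat R -> quat R} := @qconj R.
Definition qcoordL n : {linear quat R -> R^o} := qcoord n.

Section Rules.
Variables (V : normedModType R) (A : set V).
Hypothesis oA : open A.

Lemma differentiable_qmul (f g : V -> quat R) a :
  differentiable f a -> differentiable g a ->
  differentiable (fun b => f b * g b) a.
Proof. exact: (@differentiable_bilinear _ _ _ _ qmulB qmul_continuous). Qed.

Lemma derive_qmul (f g : V -> quat R) a v :
  differentiable f a -> differentiable g a ->
  'D_v (fun b => f b * g b) a = 'D_v f a * g a + f a * 'D_v g a.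
Proof. exact: (@derive_bilinear _ _ _ _ qmulB qmul_continuous). Qed.

Lemma Ck_on_qmul k (f g : V -> quat R) : Ck_on k A f -> Ck_on k A g ->
  Ck_on k A (fun a => f a * g a).
Proof. exact: (@Ck_on_bilinear _ _ _ _ qmulB qmul_continuous _ _ _ f g oA). Qed.

Lemma Ck_on_scale k (W : normedModType R) (r : V -> R) (f : V -> W) :
  Ck_on k A (r : V -> R^o) -> Ck_on k A f -> Ck_on k A (fun a => r a *: f a).
Proof. exact: (@Ck_on_bilinear _ _ _ _ (qscaleB W) (@qscale_continuous W) _ _ _ r f oA). Qed.

Lemma Ck_on_qconj k (f : V -> quat R) : Ck_on k A f ->
  Ck_on k A (fun a => qconj (f a)).
Proof. exact: (@Ck_on_linear _ _ _ _ _ _ qconjL _ oA qconj_continuous). Qed.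

Lemma derive_qconj (f : V -> quat R) a v :
  differentiable f a -> 'D_v (fun b => qconj (f b)) a = qconj ('D_v f a).
Proof. exact: (@derive_linear _ _ _ _ qconjL _ _ _ qconj_continuous). Qed.

Lemma derive_qco n (f : V -> quat R) a v :
  differentiable f a -> 'D_v (fun b => qco (f b) n : R^o) a = qco ('D_v f a) n.
Proof. exact: (@derive_linear _ _ _ _ (qcoordL n) _ _ _ (@qcoord_continuous n)). Qed.

Lemma Ck_on_qco k n (f : V -> quat R) : Ck_on k A f ->
  Ck_on k A (fun a => qco (f a) n : R^o).
Proof. exact: (@Ck_on_linear _ _ _ _ _ _ (qcoordL n) _ oA (@qcoord_continuous n)). Qed.

(** The derivative -r'/r^2 involves 1/r only to the order already known, so induction on k
    closes. *)
Lemma Ck_on_inv k (r : V -> R^o) : (forall a, A a -> r a != 0) ->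
  Ck_on k A r -> Ck_on k A (fun a => (r a)^-1 : R^o).
Proof.
move=> r0; elim: k => [|k IHk] Cr.
  by move=> a Ax; apply: continuousV; [exact: r0|exact: Cr].
have [dr Dr] := Cr; split=> [a Ax|v].
  by apply: differentiableV; [exact: dr|exact: r0].
have Ci := IHk (Ck_onS Cr).
have := Ck_on_scale (Ck_on_scale Ci Ci)
  (Ck_on_scale (@Ck_on_cst _ _ _ k A (-1 : R^o)) (Dr v)).
apply: Ck_on_eq => // a Ax.
rewrite deriveV; [|exact: r0|exact/diff_derivable/dr].
by rewrite -[RHS]/(_ * _) -[LHS]/(_ * _ * (-1 * _)) /GRing.scale /= -exprVn; ring.
Qed.

End Rules.
End QuaternionCalculus.

(** * Mean value theorem, symmetry of second derivatives, composition *)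

Section MeanValue.
Variable R : realType.
Implicit Types (V W : normedModType R).

Lemma is_derive_line V W (f : V -> W) y v t :
  differentiable f (y + t *: v) ->
  is_derive t (1 : R^o) (fun r : R^o => f (y + r *: v)) ('D_v f (y + t *: v)).
Proof.
move=> df.
have e : (fun h : R => h^-1 *: (f (y + (h *: (1 : R^o) + t) *: v) - f (y + t *: v)))
       = (fun h : R => h^-1 *: (f (h *: v + (y + t *: v)) - f (y + t *: v))).
  apply/funext => r; congr (_ *: (f _ - _)).
  by rewrite scalerDl addrCA [r *: (1 : R^o)]mulr1.
have := diff_derivable (v := v) df; rewrite /derivable /= -e => c.
by split; [exact: c|rewrite /derive /= e].
Qed.

Lemma derive_translate V W (f : V -> W) x c v :
  'D_v (fun y => f (y + c)) x = 'D_v f (x + c).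
Proof.
rewrite /derive.
have -> : (fun h : R => h^-1 *: (((fun y => f (y + c)) \o shift x) (h *: v) - f (x + c)))
        = (fun h : R => h^-1 *: ((f \o shift (x + c)) (h *: v) - f (x + c))).
  by apply/funext => r /=; rewrite addrA.
by [].
Qed.

Lemma mvt_line V (f : V -> R^o) y v (h : R) :
  (forall t, `|t| <= `|h| -> differentiable f (y + t *: v)) ->
  exists2 c, `|c| <= `|h| & f (y + h *: v) - f y = h * 'D_v f (y + c *: v).
Proof.
have pos (w : V) (r : R) : 0 <= r ->
  (forall t, `|t| <= r -> differentiable f (y + t *: w)) ->
  exists2 c, `|c| <= r & f (y + r *: w) - f y = r * 'D_w f (y + c *: w).
  move=> r0 df.
  have inr t : t \in `[0, r] -> `|t| <= r.
    by rewrite in_itv /= => /andP[t0 tr]; rewrite ger0_norm.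
  have [||c c0r fE] := @MVT_segment R (fun t : R^o => f (y + t *: w))
      (fun t => 'D_w f (y + t *: w)) 0 r r0.
  - move=> t t0r; apply: is_derive_line; apply: df; apply: inr.
    exact: subset_itv_oo_cc.
  - apply: derivable_within_continuous => t t0r.
    by have [] := is_derive_line (df _ (inr _ t0r)).
  exists c; first exact: inr.
  by move: fE; rewrite scale0r addr0 subr0 mulrC.
have [h0|h0] := leP 0 h; first by rewrite (ger0_norm h0) => df; exact: pos.
(* A negative step h along v is the positive step -h along -v. *)
rewrite (ltr0_norm h0) => df.
have h0' : 0 <= - h by rewrite oppr_ge0 ltW.
have dfN t : `|t| <= - h -> differentiable f (y + t *: - v).
  by move=> th; rewrite scalerN -scaleNr; apply: df; rewrite normrN.
have [c ch] := pos _ _ h0' dfN.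
rewrite !scalerN scaleNr opprK -scaleNr => fE; exists (- c); first by rewrite normrN.
rewrite fE deriveE; last by apply: df; rewrite normrN.
by rewrite linearN -deriveE ?mulrNN //; apply: df; rewrite normrN.
Qed.

Lemma near_parallelogram V (A : set V) x u w : nbhs x A ->
  exists2 d : R, 0 < d & forall a b : R, `|a| <= d -> `|b| <= d ->
    A (x + a *: u + b *: w).
Proof.
move=> nA; pose g (p : R * R) : V := x + p.1 *: u + p.2 *: w.
have cg : {for (0, 0), continuous g}.
  apply: continuousD; first apply: continuousD.
  - exact: cst_continuous.
  - by apply: continuousZr_tmp; exact: cvg_fst.
  - by apply: continuousZr_tmp; exact: cvg_snd.
have g0 : g (0, 0) = x by rewrite /g !scale0r !addr0.
have := cg A; rewrite g0 => /(_ nA) /nbhs_ballP[e /= e0 eA].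
exists (e / 2); first by rewrite divr_gt0.
have lt (t : R) : `|t| <= e / 2 -> `|0 - t| < e.
  by move=> te; rewrite sub0r normrN (le_lt_trans te) // ltr_pdivrMr // ltr_pMr // ltr1n.
by move=> a b /lt ae /lt be; apply: (eA (a, b)); split; rewrite /= -ball_normE.
Qed.

(* Both sides are limits of the second difference of f along the parallelogram
   spanned by h u and h w, divided by h^2. *)
Lemma derive_comm V (A : set V) (f : V -> R^o) u w x : open A -> A x ->
  Ck_on 2 A f -> 'D_u ('D_w f) x = 'D_w ('D_u f) x.
Proof.
move=> oA Ax [df Df].
pose swap (u w : V) := forall e : R, 0 < e -> exists2 d : R, 0 < d &
  forall h : R, 0 < h -> h <= d ->
  `|(f (x + h *: u + h *: w) - f (x + h *: u) - f (x + h *: w) + f x) / (h * h)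
    - 'D_w ('D_u f) x| <= e.
have key : forall u w, swap u w.
  move=> {}u {}w e e0; have [duf Duf] := Df u.
  have cDD : {for x, continuous ('D_w ('D_u f))} by exact: (Duf w).
  have nDD : nbhs x [set y | A y /\ `|'D_w ('D_u f) y - 'D_w ('D_u f) x| <= e].
    apply: filterI; first exact: open_nbhs_nbhs.
    by move/cvgrPdistC_le : cDD; exact.
  have [d d0 dA] := near_parallelogram u w nDD; exists d => // h h0 hd.
  have nh (t : R) : `|t| <= `|h| -> `|t| <= d by rewrite (gtr0_norm h0) => /le_trans; exact.
  pose g y := f (y + h *: w) - f y.
  have dg1 (t : R) : `|t| <= `|h| -> differentiable (fun y => f (y + h *: w)) (x + t *: u).
    move=> th; apply: (@differentiable_comp _ _ _ _ (fun y => y + h *: w) f).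
      by apply: differentiableD.
    by apply: df; have [] := dA t h (nh _ th) (nh _ (lexx _)).
  have dg2 (t : R) : `|t| <= `|h| -> differentiable f (x + t *: u).
    by move=> th; apply: df; have := dA t 0 (nh _ th);
      rewrite scale0r addr0 normr0 => /(_ (ltW d0))[].
  have [t th|c ch gE] := @mvt_line V g x u h.
    exact: differentiableB (dg1 t th) (dg2 t th).
  have Dg : 'D_u g (x + c *: u) = 'D_u f (x + c *: u + h *: w) - 'D_u f (x + c *: u).
    rewrite deriveB; [|exact/diff_derivable/dg1|exact/diff_derivable/dg2].
    by rewrite derive_translate.
  have [t th|c' ch' DE] := @mvt_line V ('D_u f) (x + c *: u) w h.
    by apply: duf; have [] := dA c t (nh _ ch) (nh _ th).
  have [_] := dA c c' (nh _ ch) (nh _ ch').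
  set D := 'D_w _ (_ + _ + _) in DE *.
  suff -> : f (x + h *: u + h *: w) - f (x + h *: u) - f (x + h *: w) + f x = h * (h * D).
    by rewrite mulrA mulrAC mulfV ?mul1r // mulf_neq0 // gt_eqF.
  by rewrite -DE -Dg -gE /g; ring.
apply/eqP; rewrite -subr_eq0 -normr_le0; apply/ler_addgt0Pl => e e0; rewrite addr0.
have e2 : 0 < e / 2 by rewrite divr_gt0.
have [d1 d10 k1] := key u w _ e2; have [d2 d20 k2] := key w u _ e2.
pose h := Num.min d1 d2.
have h0 : 0 < h by rewrite lt_min d10.
have {}k1 := k1 h h0 ltac:(by rewrite ge_min lexx).
have {}k2 := k2 h h0 ltac:(by rewrite ge_min lexx orbT).
set q := _ / _ in k1.
have qE : q = (f (x + h *: w + h *: u) - f (x + h *: w) - f (x + h *: u) + f x) / (h * h).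
  by rewrite /q [x + h *: u + _]addrAC; congr (_ / _); ring.
rewrite -qE distrC in k2.
by rewrite (splitr e) -(subrKA q) (le_trans (ler_normD _ _)) // lerD.
Qed.
End MeanValue.

Section Composition.
Variable R : realType.
Implicit Types (V W : normedModType R).

Definition fstL : {linear (R * R)%type -> R^o} := (@fst R^o R^o).
Definition sndL : {linear (R * R)%type -> R^o} := (@snd R^o R^o).

Lemma fst_continuous : continuous (fst : R * R -> R).
Proof. by move=> p; exact: cvg_fst. Qed.

Lemma snd_continuous : continuous (snd : R * R -> R).
Proof. by move=> p; exact: cvg_snd. Qed.

Lemma derive_basis W (f : R * R -> W) z (X : R * R) : differentiable f z ->
  'D_X f z = X.1 *: 'D_(1, 0) f z + X.2 *: 'D_(0, 1) f z.
Proof.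
move=> df; rewrite !deriveE // -!linearZ -linearD; congr ('d f z _).
by case: X => a b; congr pair; rewrite /= /GRing.scale /= !(mulr1, mulr0, addr0, add0r).
Qed.

Lemma derive_comp_plane V W (phi : V -> R * R) (f : R * R -> W) x v :
  differentiable phi x -> differentiable f (phi x) ->
  'D_v (fun y => f (phi y)) x = 'D_('D_v phi x) f (phi x).
Proof.
move=> dphi df; rewrite !deriveE //; last exact: (differentiable_comp dphi df).
by rewrite [LHS](congr1 (@^~ v) (diff_comp dphi df)).
Qed.

Lemma Ck_on_fst V k (A : set V) (phi : V -> R * R) : open A ->
  Ck_on k A phi -> Ck_on k A (fun x => (phi x).1 : R^o).
Proof. by move=> oA; exact: (@Ck_on_linear _ _ _ _ _ _ fstL _ oA fst_continuous). Qed.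

Lemma Ck_on_snd V k (A : set V) (phi : V -> R * R) : open A ->
  Ck_on k A phi -> Ck_on k A (fun x => (phi x).2 : R^o).
Proof. by move=> oA; exact: (@Ck_on_linear _ _ _ _ _ _ sndL _ oA snd_continuous). Qed.

Lemma Ck_on_pair V k (A : set V) (a b : V -> R^o) : open A ->
  Ck_on k A a -> Ck_on k A b -> Ck_on k A (fun x => (a x, b x) : R * R).
Proof.
move=> oA Ca Cb.
have := Ck_onD oA (Ck_on_scale oA Ca (@Ck_on_cst _ _ _ k A ((1, 0) : R * R)))
  (Ck_on_scale oA Cb (@Ck_on_cst _ _ _ k A ((0, 1) : R * R))).
apply: Ck_on_eq => // x _.
by congr pair; rewrite /= /GRing.scale /= !(mulr1, mulr0, addr0, add0r).
Qed.

(** With the plane in the middle, the chain rule is a sum of two products of partial derivatives, so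
    the induction needs only sums, scalings and the same statement for the partials of f. *)
Lemma Ck_on_comp_plane V W k (A : set V) (B : set (R * R)) (phi : V -> R * R)
  (f : R * R -> W) : open A -> (forall x, A x -> B (phi x)) ->
  Ck_on k A phi -> Ck_on k B f -> Ck_on k A (fun x => f (phi x)).
Proof.
move=> oA AB; elim: k phi f AB => [|k IHk] phi f AB.
  move=> Cphi Cf x Ax; apply: (@continuous_comp _ _ _ phi f); first exact: Cphi.
  by apply: Cf; exact: AB.
move=> Cphi [df Df]; have [dphi Dphi] := Cphi; split=> [x Ax|v].
  exact: (differentiable_comp (dphi x Ax) (df _ (AB x Ax))).
have CD w : Ck_on k A (fun x => 'D_w f (phi x)).
  exact: (IHk phi ('D_w f) AB (Ck_onS Cphi) (Df w)).
have := Ck_onD oA (Ck_on_scale oA (Ck_on_fst oA (Dphi v)) (CD (1, 0)))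
  (Ck_on_scale oA (Ck_on_snd oA (Dphi v)) (CD (0, 1))).
apply: Ck_on_eq => // x Ax.
rewrite (derive_comp_plane v (dphi x Ax) (df _ (AB x Ax))).
by rewrite [RHS](derive_basis _ (df _ (AB x Ax))).
Qed.

(** Together with [derive_slice1], this turns derivatives along the surface and in t into
    directional derivatives of one function of (t, z), where they can be interchanged. *)
Lemma derive_slice V W W' (G : V * W -> W') s z X :
  'D_X (fun y => G (s, y)) z = 'D_(0, X) G (s, z).
Proof.
rewrite /derive.
have -> : (fun h : R => h^-1 *: (((fun y => G (s, y)) \o shift z) (h *: X) - G (s, z)))
  = (fun h : R => h^-1 *: ((G \o shift (s, z)) (h *: (0, X)) - G (s, z))).
  apply/funext => h; rewrite /=; do 3 f_equal.
  by rewrite -[RHS]/(h *: 0 + s, h *: X + z) scaler0 add0r.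
by [].
Qed.

Lemma derive_slice1 W W' (G : R * W -> W') s z :
  'D_1 (fun t : R => G (t, z)) s = 'D_(1, 0) G (s, z).
Proof.
rewrite /derive.
have -> : (fun h : R => h^-1 *: (((fun y : R => G (y, z)) \o shift s) (h *: (1 : R)) - G (s, z)))
  = (fun h : R => h^-1 *: ((G \o shift (s, z)) (h *: (1, 0)) - G (s, z))).
  apply/funext => h; rewrite /=; do 3 f_equal.
  by rewrite -[RHS]/(h *: 1 + s, h *: 0 + z) scaler0 add0r.
by [].
Qed.

Lemma Ck_on_slice V W W' k (A : set (V * W)) (G : V * W -> W') s :
  Ck_on k A G -> Ck_on k [set z | A (s, z)] (fun z => G (s, z)).
Proof.
elim: k G => [|k IHk] G.
  move=> CG z Az; apply: (@continuous_comp _ _ _ (fun z => (s, z)) G).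
    by apply: cvg_pair; [exact: cst_continuous|exact: cvg_id].
  exact: CG.
move=> [dG DG]; split=> [z Az|X].
  apply: (@differentiable_comp _ _ _ _ (fun z => (s, z)) G); last exact: dG.
  by apply: differentiable_pair.
have <- : (fun z => 'D_(0, X) G (s, z)) = 'D_X (fun z => G (s, z)).
  by apply/funext => z; rewrite derive_slice.
exact: (IHk _ (DG (0, X))).
Qed.

(** Coordinate by coordinate, since the mean value theorem behind [derive_comm] is for real
    functions. *)
Lemma derive_comm_quat V (A : set V) (f : V -> quat R) u w x : open A -> A x ->
  smooth_on A f -> 'D_u ('D_w f) x = 'D_w ('D_u f) x.
Proof.
move=> oA Ax sf.
have key n : qco ('D_u ('D_w f) x) n = qco ('D_w ('D_u f) x) n.
  have E v1 v2 : qco ('D_v1 ('D_v2 f) x) n =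
      'D_v1 ('D_v2 (fun y => qco (f y) n : R^o)) x.
    rewrite -derive_qco; last exact: smooth_on_differentiable (smooth_on_derive _ sf) Ax.
    apply: near_eq_derive; have : \forall y \near x, A y by exact: open_nbhs_nbhs.
    apply: filterS => y Ay.
    by rewrite derive_qco //; exact: smooth_on_differentiable sf Ay.
  apply: etrans (E u w) (etrans _ (esym (E w u))).
  have Cf : Ck_on 2 A (fun y => qco (f y) n : R^o).
    exact: (@Ck_on_qco R V A oA 2 n f (sf 2%N)).
  exact: derive_comm oA Ax Cf.
by apply: quatP.
Qed.

(** A ball inside A is convex, so the mean value theorem applies on the segment from x to y. *)
Lemma locally_constant V (A : set V) (f : V -> R^o) x : open A -> A x ->
  (forall y, A y -> differentiable f y) -> (forall y v, A y -> 'D_v f y = 0) ->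
  \forall y \near x, f y = f x.
Proof.
move=> oA Ax df Df.
have /nbhs_ballP[e /= e0 eA] : nbhs x A by exact: open_nbhs_nbhs.
apply/nbhs_ballP; exists e => //= y.
rewrite -ball_normE /= => xy.
have At (t : R) : `|t| <= `|1 : R| -> A (x + t *: (y - x)).
  rewrite normr1 => t1; apply: eA; rewrite -ball_normE /= opprD addNKr normrN normrZ.
  by rewrite (le_lt_trans _ xy) // -normrN opprB ler_piMl.
have [t t1|c c1] := @mvt_line R V f x (y - x) 1; first exact: df (At t t1).
by rewrite Df ?mulr0; [move/subr0_eq; rewrite scale1r subrKC|exact: At].
Qed.
End Composition.

(** * Quaternion algebra *)

Section QuaternionAlgebra.
Variable R : realType.
Implicit Types x y z N d : quat R.

Lemma mulq_real x (r : R) : x * (r *: 1) = r *: x.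
Proof. by rewrite -qscaleAr mulr1. Qed.

Lemma qconjM x y : qconj (x * y) = qconj y * qconj x.
Proof. by apply: quatP; rewrite !qsimp; ring. Qed.

Lemma qmul_conj x : x * qconj x = qnorm2 x *: 1.
Proof. by apply: quatP; rewrite !qsimp /qnorm2; ring. Qed.

Lemma qconj_mul x : qconj x * x = qnorm2 x *: 1.
Proof. by apply: quatP; rewrite !qsimp /qnorm2; ring. Qed.

Lemma qnorm2M x y : qnorm2 (x * y) = qnorm2 x * qnorm2 y.
Proof. by rewrite /qnorm2 !qsimp; ring. Qed.

Lemma qinvE x : x^-1 = (qnorm2 x)^-1 *: qconj x.
Proof. by []. Qed.

Lemma qmulV x : x != 0 -> x * x^-1 = 1.
Proof. by move=> x0; apply: qmulqV. Qed.

Lemma qmulVl x : x != 0 -> x^-1 * x = 1.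
Proof. by move=> x0; apply: qmulVq. Qed.

Lemma re_mulC x y : qco (x * y) 0 = qco (y * x) 0.
Proof. by rewrite !qsimp; ring. Qed.

Lemma qexpiV t : (qexpi t : quat R)^-1 = qexpi (- t).
Proof.
have n1 : qnorm2 (qexpi t : quat R) = 1.
  by rewrite /qnorm2 !qco_mkq -(cos2Dsin2 t); ring.
by rewrite qinvE n1 invr1 scale1r; apply: quatP;
  rewrite !(qsimp, qco_mkq) ?cosN ?sinN ?oppr0.
Qed.

Lemma acoef_qexpi t : acoef (qexpi t : quat R) = cos t *: 1.
Proof.
rewrite /acoef qexpiV; apply: quatP;
  rewrite !(qsimp, qco_mkq) ?cosN ?sinN; lra.
Qed.

Lemma bcoef_qexpi t : bcoef (qexpi t : quat R) = sin t *: 1.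
Proof.
rewrite /bcoef qexpiV; apply: quatP;
  rewrite !(qsimp, qco_mkq) ?cosN ?sinN; lra.
Qed.

(* The plane R + R N is a copy of the complex numbers when N^2 = -1. *)
Definition cplx N (a b : R) : quat R := a *: 1 + b *: N.

Lemma cplxM N a b a' b' : N * N = -1 ->
  cplx N a b * cplx N a' b' = cplx N (a * a' - b * b') (a * b' + b * a').
Proof.
move=> NN; rewrite /cplx mulrDl !mulrDr !mulq_real -!scalerAl !mul1r -!qscaleAr NN.
by apply: quatP; rewrite !qsimp; ring.
Qed.

Lemma cplx_anti N d a b : d * N = - (N * d) ->
  cplx N a b * d = d * cplx N a (- b).
Proof.
move=> dN; rewrite /cplx mulrDl mulrDr -!scalerAl mul1r mulq_real -qscaleAr dN.
by rewrite scalerN scaleNr opprK.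
Qed.

Lemma cplxD N a b a' b' : cplx N a b + cplx N a' b' = cplx N (a + a') (b + b').
Proof. by rewrite /cplx !scalerDl addrACA. Qed.

Lemma cplxZ N r a b : r *: cplx N a b = cplx N (r * a) (r * b).
Proof. by rewrite /cplx scalerDr !scalerA. Qed.

Lemma cplxN N a b : - cplx N a b = cplx N (- a) (- b).
Proof. by rewrite -scaleN1r cplxZ !mulN1r. Qed.

Lemma cplx_real N a : a *: 1 = cplx N a 0.
Proof. by rewrite /cplx scale0r addr0. Qed.

Lemma cplx_imag N : N = cplx N 0 1.
Proof. by rewrite /cplx scale0r add0r scale1r. Qed.

(* For lambda = e^{it} one has a_lambda = cos t and b_lambda = sin t, so that
   d_lambda alpha = 0 reads d alpha = - (1/2) dh (Kt N t) alpha. *)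
Definition Kt N (t : R) : quat R := cplx N (sin t) (cos t - 1).

Lemma conn_coef N x t :
  N * x * (acoef (qexpi t) - 1) + x * bcoef (qexpi t) = Kt N t * x.
Proof.
rewrite acoef_qexpi bcoef_qexpi -[X in _ - X]scale1r -scalerBl !mulq_real.
by rewrite /Kt /cplx mulrDl addrC -!scalerAl mul1r.
Qed.

(** The right-hand factor is [Kt (- N) t]: the beta component of the constrained Willmore connection
    is the CMC connection of the parallel surface h + N, whose Gauss map is -N. *)
Lemma conn_coefN N x t :
  - (N * x * (acoef (qexpi t) - 1)) + x * bcoef (qexpi t) =
  cplx N (sin t) (1 - cos t) * x.
Proof.
rewrite acoef_qexpi bcoef_qexpi -[X in _ - X]scale1r -scalerBl !mulq_real.
by rewrite /cplx mulrDl addrC -!scalerAl mul1r -scaleNr opprB.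
Qed.

End QuaternionAlgebra.

(** * Noncommutative identities behind the derivative formulas *)

Lemma qscalel (R : realType) (r : R) (x y : quat R) :
  (r *: x) * y = r *: (x * y).
Proof. by rewrite scalerAl. Qed.

Lemma qscaler (R : realType) (r : R) (x y : quat R) :
  x * (r *: y) = r *: (x * y).
Proof. by rewrite qscaleAr. Qed.

Lemma cplx_commN (R : realType) (n : quat R) a b : cplx n a b * n = n * cplx n a b.
Proof. by rewrite /cplx mulrDl mulrDr mulq_real qscalel mul1r qscalel qscaler. Qed.

(** [qnorm] expands into monomials, associated to the left and with real factors in front. Once the
    monomials are abstracted by [set], the identity is real-linear in them and [qlin] checks it on
    coordinates. *)
Ltac qnorm := rewrite ?(mulrDl, mulrDr, mulrBl, mulrBr, mulNr, mulrN, opprK,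
  opprD, scalerDr, scalerN, mulrA, qscalel, qscaler, scalerA).
Ltac qlin := apply: quatP; rewrite ?(qcoD, qcoN, qcoZ, qco0); lra.

Section Identities.
Variable R : realType.
Implicit Types p a b t d n dn K : quat R.

(** Here K' stands for dK/dt and t for d alpha/dt. The K t terms coming from d(alpha^-1) and from
    d(d alpha/dt) cancel, so only the t-derivative of the connection survives. *)
Lemma derive_fa_alg p t a d K K' :
  - 2 *: ((2^-1 *: (p * (d * K))) * t + p * - (2^-1 *: (d * (K' * a + K * t)))) =
  p * (d * (K' * a)).
Proof.
qnorm; set x := p * d * K * t; set y := p * d * K' * a; qlin.
Qed.

Lemma derive_Na_alg p a d n dn K : d * n = - (n * d) -> K * n = n * K ->
  (2^-1 *: (p * (d * K)) * n + p * dn) * a + p * n * - (2^-1 *: (d * (K * a))) =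
  p * (dn + d * (n * K)) * a.
Proof.
move=> dn0 Kn; have nd : n * d = - (d * n) by rewrite dn0 opprK.
rewrite mulrDl !qscalel -!mulrA (mulrA K n) Kn (mulrN n) (qscaler _ n) (mulrA n d) nd.
qnorm; set x := p * d * n * K * a; set y := p * dn * a; qlin.
Qed.

Lemma derive_al_alg p b d K K' :
  2^-1 *: (p * (d * K)) * b + p * - (2^-1 *: (d * (K' * b))) =
  - (2^-1 *: (p * (d * ((K' - K) * b)))).
Proof.
qnorm; set x := p * d * K * b; set y := p * d * K' * b; qlin.
Qed.

(** In the complex plane spanned by 1 and n one has [Kt n s] = n (e^{-ns} - 1). Moving L past d
    conjugates it, and the identity rests on K L - conj(L) K' = 2 (cos tau - 1), with K' taken at s
    + tau. *)
Lemma derive_be_alg p b d n dn (c sg c' sg' : R) :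
  d * n = - (n * d) -> n * n = -1 -> c' ^+ 2 + sg' ^+ 2 = 1 ->
  let K := cplx n sg (c - 1) in let L := cplx n sg' (c' - 1) in
  let K' := cplx n (sg * c' + c * sg') (c * c' - sg * sg' - 1) in
  2^-1 *: (p * (d * K)) * (L * b) +
    p * (((c' - 1) *: dn) * b + L * - (2^-1 *: (d * (K' * b)))) =
  - (2^-1 *: (p * ((d + dn) * ((2 - 2 * c') *: b)))).
Proof.
move=> dn0 nn cs K L K'.
have Ld : L * d = d * cplx n sg' (1 - c') by rewrite cplx_anti // opprB.
have KL : K * L = cplx n sg' (1 - c') * K' + (2 * (c' - 1)) *: 1.
  rewrite (cplx_real n (2 * _)) !cplxM // cplxD.
  have cs' : c' ^+ 2 = 1 - sg' ^+ 2 by rewrite -cs addrK.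
  by congr (cplx n _ _); ring: cs'.
rewrite mulrN qscaler (mulrA L d) Ld !qscalel -!mulrA (mulrA K L) KL.
move: (cplx n sg' (1 - c')) (K') => M M'; rewrite (mulrDl (M * M')) qscalel mul1r.
qnorm; set x := p * d * M * M' * b; set y := p * dn * b; set z := p * d * b; qlin.
Qed.
(** Applied with K = cos s - N sin s from d f^alpha and K' = N [Kt N s] from d N^alpha; their sum is
    1, so s drops out of the differential of the parallel surface. *)
Lemma derive_ga_alg p a d dn K K' : K + K' = 1 ->
  p * (d * (K * a)) + p * (dn + d * K') * a = p * (d + dn) * a.
Proof.
move=> /(canRL (addrK K')) ->; qnorm; rewrite !mulr1.
set x := p * d * a; set y := p * dn * a; set z := p * d * K' * a; qlin.
Qed.
End Identities.

(** * The associated family in a chart *)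

(* H and N stand for the surface and its Gauss map, G (t, z) for alpha(t) at z,
   P for alpha^-1, fa and Na for f^alpha and N^alpha, al for the section
   alpha^-1 alpha(s + tau), which is parallel for f^alpha and e^{i tau}, and be
   for the corresponding section N^alpha al (cos tau - 1) + al sin tau of the
   parallel surface f^alpha + N^alpha.  P, T, ... are variables equal to their
   values, so that rewriting does not unfold them. *)
Section LocalCalculus.
Variable R : realType.
Variables (U : set (R * R)) (H N : R * R -> quat R) (s e : R).
Variables (G : R * (R * R) -> quat R) (c0 : R).

Let I : set R := `]s - e, s + e[.

Hypothesis oU : open U.
Hypothesis e0 : 0 < e.
Hypothesis sG : smooth_on (I `*` U) G.
Hypothesis NN : forall z, U z -> N z * N z = -1.
Hypothesis dN : forall z, U z -> differentiable N z.
Hypothesis anti : forall z (X : R * R), U z -> 'D_X H z * N z = - (N z * 'D_X H z).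
Hypothesis eqG : forall t z (X : R * R), I t -> U z ->
  'D_X (fun y => G (t, y)) z = - (2^-1 *: ('D_X H z * (Kt (N z) t * G (t, z)))).
Hypothesis c00 : c0 != 0.
Hypothesis nG : forall z, U z -> qnorm2 (G (s, z)) = c0.

Variables P T fa Na : R * R -> quat R.
Hypothesis PE : P = fun z => c0^-1 *: qconj (G (s, z)).
Hypothesis TE : T = fun z => 'D_(1, 0) G (s, z).
Hypothesis faE : fa = fun z => - 2 *: (P z * T z).
Hypothesis NaE : Na = fun z => P z * N z * G (s, z).

Lemma slice_center : I s.
Proof. by rewrite /I /= in_itv /= ltrDl e0 andbT ltrBlDr ltrDl. Qed.

Lemma open_slab : open (I `*` U).
Proof.
rewrite openE => -[t z] [/= It Uz]; exists (I, U) => //; split => /=.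
  by apply: open_nbhs_nbhs; split => //; exact: interval_open.
exact: open_nbhs_nbhs.
Qed.

Lemma smooth_on_slice (W : normedModType R) (F : R * (R * R) -> W) t : I t ->
  smooth_on (I `*` U) F -> smooth_on U (fun z => F (t, z)).
Proof.
move=> It sF k; have := @Ck_on_slice _ _ _ _ k _ F t (sF k).
by apply: Ck_on_sub => z Uz; split.
Qed.

Lemma smooth_slice t : I t -> smooth_on U (fun z => G (t, z)).
Proof. by move=> It; exact: smooth_on_slice. Qed.

(** The constant norm makes alpha^-1 linear in alpha, so no smooth division is involved. *)
Lemma smooth_P : smooth_on U P.
Proof.
rewrite PE => k; have C := Ck_on_qconj oU (smooth_slice slice_center k).
exact: (Ck_on_scale oU (@Ck_on_cst _ _ _ k U (c0^-1 : R^o)) C).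
Qed.

Lemma smooth_T : smooth_on U T.
Proof. by rewrite TE; exact: (smooth_on_slice slice_center (smooth_on_derive _ sG)). Qed.

Lemma smooth_fa : smooth_on U fa.
Proof.
rewrite faE => k; have C := Ck_on_qmul oU (smooth_P k) (smooth_T k).
exact: (Ck_on_scale oU (@Ck_on_cst _ _ _ k U (- 2 : R^o)) C).
Qed.

Lemma PG z : U z -> P z * G (s, z) = 1.
Proof.
move=> Uz; rewrite PE -scalerAl qconj_mul nG // scalerA mulVf //.
by rewrite scale1r.
Qed.

Lemma GP z : U z -> G (s, z) * P z = 1.
Proof.
move=> Uz; rewrite PE -qscaleAr qmul_conj nG // scalerA mulVf //.
by rewrite scale1r.
Qed.

Lemma derive_P z (X : R * R) : U z ->
  'D_X P z = 2^-1 *: (P z * ('D_X H z * Kt (N z) s)).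
Proof.
move=> Uz; have dP := smooth_on_differentiable smooth_P Uz.
have dG := smooth_on_differentiable (smooth_slice slice_center) Uz.
have : 'D_X (fun y => P y * G (s, y)) z = 0.
  rewrite -(derive_cst (1 : quat R) z X); apply: near_eq_derive.
  have : \forall y \near z, U y by exact: open_nbhs_nbhs.
  by apply: filterS => y; exact: PG.
(* Differentiating P alpha = 1 and multiplying by P on the right solves for dP. *)
rewrite (derive_qmul X dP dG) (eqG X slice_center Uz) => /(congr1 ( *%R^~ (P z))).
rewrite mulrDl mul0r -(mulrA _ (G (s, z)) (P z)) GP // mulr1 => /eqP; rewrite addr_eq0 => /eqP ->.
by rewrite mulrN mulNr opprK -qscaleAr -scalerAl -!mulrA GP // mulr1.
Qed.

Lemma derive_scalel (r : R^o -> R^o) (c : quat R) t : derivable r t 1 ->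
  is_derive t (1 : R^o) (fun t : R^o => r t *: c) ('D_1 r t *: c).
Proof.
move=> /derivable1_diffP dr; have d := differentiableZl c dr.
split; first exact: diff_derivable.
by rewrite !deriveE // (diffZl c dr).
Qed.

Lemma derive_Kt n t :
  is_derive t (1 : R^o) (fun t : R^o => Kt n t) (cplx n (cos t) (- sin t)).
Proof.
have ds := derive_scalel (1 : quat R) (@ex_derive _ _ _ _ _ _ _ (is_derive_sin t)).
have Dc : is_derive t (1 : R^o) (fun t : R^o => cos t - 1 : R^o) (- sin t).
  by apply: is_derive_eq; rewrite subr0.
have dc := derive_scalel n (@ex_derive _ _ _ _ _ _ _ Dc).
apply: (is_derive_eq (is_deriveD ds dc)).
by rewrite !derive_val.
Qed.

(** The derivatives in t and X are interchanged and the parallel equation is differentiated in t;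
    [cplx (N z) (cos s) (- sin s)] is dK/dt at s. *)
Lemma derive_T z (X : R * R) : U z -> 'D_X T z = - (2^-1 *: ('D_X H z *
  (cplx (N z) (cos s) (- sin s) * G (s, z) + Kt (N z) s * T z))).
Proof.
move=> Uz.
have Is := slice_center.
have -> : 'D_X T z = 'D_(1, 0) ('D_(0, X) G) (s, z).
  rewrite TE (derive_slice ('D_(1, 0) G)).
  exact: derive_comm_quat open_slab _ sG.
rewrite -(derive_slice1 ('D_(0, X) G)).
pose F (t : R^o) : quat R := - (2^-1 *: ('D_X H z * (Kt (N z) t * G (t, z)))).
have -> : 'D_1 (fun t : R => 'D_(0, X) G (t, z)) s = 'D_1 F s.
  apply: near_eq_derive.
  have : \forall t \near s, I t.
    by apply: open_nbhs_nbhs; split => //; exact: interval_open.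
  by apply: filterS => t It; rewrite -derive_slice; exact: eqG.
have dG : differentiable (fun t : R^o => G (t, z)) s.
  apply: (@differentiable_comp _ _ _ _ (fun t : R^o => (t, z)) G).
    exact: differentiable_pair.
  exact: smooth_on_differentiable sG _.
have dK : differentiable (fun t : R^o => Kt (N z) t) s.
  by apply/derivable1_diffP; have [] := derive_Kt (N z) s.
have dKG := differentiable_qmul dK dG.
have dc := differentiable_cst ('D_X H z) (s : R^o).
have dM := differentiable_qmul dc dKG.
rewrite /F deriveN; last exact/diff_derivable/differentiableZ.
rewrite (deriveZ _ (diff_derivable dM)) (derive_qmul (1 : R^o) dc dKG) derive_cst mul0r add0r.
rewrite (derive_qmul (1 : R^o) dK dG) (@derive_val _ _ _ _ _ _ _ (derive_Kt (N z) s)).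
by rewrite derive_slice1 TE.
Qed.

Lemma derive_fa z (X : R * R) : U z ->
  'D_X fa z = P z * ('D_X H z * (cplx (N z) (cos s) (- sin s) * G (s, z))).
Proof.
move=> Uz; have dP := smooth_on_differentiable smooth_P Uz.
have dT := smooth_on_differentiable smooth_T Uz.
have dPT := differentiable_qmul dP dT.
rewrite faE (deriveZ _ (diff_derivable dPT)) (derive_qmul X dP dT).
by rewrite derive_P // derive_T // derive_fa_alg.
Qed.

Lemma derive_Na z (X : R * R) : U z ->
  'D_X Na z = P z * ('D_X N z + 'D_X H z * (N z * Kt (N z) s)) * G (s, z).
Proof.
move=> Uz; have dP := smooth_on_differentiable smooth_P Uz.
have dG := smooth_on_differentiable (smooth_slice slice_center) Uz.
have dPN := differentiable_qmul dP (dN Uz).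
rewrite NaE (derive_qmul X dPN dG) (derive_qmul X dP (dN Uz)) (eqG X slice_center Uz).
rewrite derive_P // derive_Na_alg //; first exact: anti.
exact: cplx_commN.
Qed.

Section Deformation.
Variables (tau : R).
Hypothesis It : I (s + tau).

Variables L Gt al be : R * R -> quat R.
Hypothesis LE : L = fun z => Kt (N z) tau.
Hypothesis GtE : Gt = fun z => G (s + tau, z).
Hypothesis alE : al = fun z => P z * Gt z.
Hypothesis beE : be = fun z => P z * (L z * Gt z).

Lemma derive_al z (X : R * R) : U z ->
  'D_X al z = - (2^-1 *: ('D_X fa z * be z)).
Proof.
move=> Uz; have dP := smooth_on_differentiable smooth_P Uz.
have dG := smooth_on_differentiable (smooth_slice It) Uz.
rewrite alE GtE (derive_qmul X dP dG) (eqG X It Uz) derive_P // derive_fa // beE GtE.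
(* With K(t) = N (e^{-Nt} - 1), this is e^{-Ns} K(tau) = K(s + tau) - K(s). *)
have E : cplx (N z) (cos s) (- sin s) * L z = Kt (N z) (s + tau) - Kt (N z) s.
  rewrite LE /Kt (cplxM _ _ _ _ (NN Uz)) cplxN cplxD cosD sinD; congr cplx; ring.
have E' : P z * ('D_X H z * (cplx (N z) (cos s) (- sin s) * G (s, z))) *
    (P z * (L z * G (s + tau, z))) =
    P z * ('D_X H z * ((cplx (N z) (cos s) (- sin s) * L z) * G (s + tau, z))).
  by rewrite -!mulrA (mulrA (G _) (P z)) GP // mul1r.
by rewrite E' E derive_al_alg.
Qed.

Lemma derive_be z (X : R * R) : U z ->
  'D_X be z = - (2^-1 *: ('D_X (fun y => fa y + Na y) z *
     (cplx (Na z) (sin tau) (1 - cos tau) * be z))).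
Proof.
move=> Uz; have dP := smooth_on_differentiable smooth_P Uz.
have dGt := smooth_on_differentiable (smooth_slice It) Uz.
have dfa := smooth_on_differentiable smooth_fa Uz.
have dGs := smooth_on_differentiable (smooth_slice slice_center) Uz.
have dNa : differentiable Na z.
  by rewrite NaE; exact: differentiable_qmul (differentiable_qmul dP (dN Uz)) dGs.
have dcN := differentiableZ (cos tau - 1) (dN Uz).
have dc := differentiable_cst (sin tau *: (1 : quat R)) z.
have dL : differentiable L z by rewrite LE; exact: differentiableD dc dcN.
have DL : 'D_X L z = (cos tau - 1) *: 'D_X N z.
  rewrite LE (deriveD (diff_derivable dc) (diff_derivable dcN)) derive_cst add0r.
  by rewrite (deriveZ _ (diff_derivable (dN Uz))).
have dLG := differentiable_qmul dL dGt.
have Dg : 'D_X (fun y => fa y + Na y) z = P z * ('D_X H z + 'D_X N z) * G (s, z).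
  rewrite (deriveD (diff_derivable dfa) (diff_derivable dNa)) derive_fa // derive_Na //.
  have NK : N z * Kt (N z) s = cplx (N z) (1 - cos s) (sin s).
    by rewrite {1}[N z](cplx_imag (N z)) /Kt (cplxM _ _ _ _ (NN Uz)); congr cplx; ring.
  apply: derive_ga_alg; rewrite NK cplxD -[RHS]scale1r (cplx_real (N z)).
  by congr cplx; ring.
(* N^alpha is the conjugate of N by alpha, so P carries the plane of N to that of N^alpha. *)
have aE : cplx (Na z) (sin tau) (1 - cos tau) * P z = P z * cplx (N z) (sin tau) (1 - cos tau).
  rewrite NaE /cplx mulrDl mulrDr !qscalel mul1r !qscaler mulr1 -!mulrA.
  by rewrite (GP Uz) mulr1.
rewrite beE GtE (derive_qmul X dP dLG) (derive_qmul X dL dGt) DL derive_P // Dg.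
rewrite (eqG X It Uz).
rewrite (mulrA _ (P z)) aE -!mulrA (mulrA (G (s, z)) (P z)) GP // mul1r (mulrA _ (L z)).
rewrite LE /Kt cosD sinD.
rewrite derive_be_alg ?anti ?NN ?cos2Dsin2 //.
have cs : cos tau ^+ 2 = 1 - sin tau ^+ 2 by rewrite cos2sin2.
(* The two factors are conjugate, and the product is the squared norm of [Kt N tau]. *)
have -> : cplx (N z) (sin tau) (1 - cos tau) * cplx (N z) (sin tau) (cos tau - 1) =
    (2 - 2 * cos tau) *: 1.
  rewrite (cplxM _ _ _ _ (NN Uz)) (cplx_real (N z)).
  by congr (cplx (N z) _ _); ring: cs.
by rewrite qscalel mul1r.
Qed.

Lemma smooth_al : smooth_on U al.
Proof. by rewrite alE GtE => k; exact: (Ck_on_qmul oU (smooth_P k) (smooth_slice It k)). Qed.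

Lemma smooth_be : smooth_on U N -> smooth_on U be.
Proof.
move=> sN k; rewrite beE GtE LE.
have Cc : Ck_on k U (fun=> sin tau *: (1 : quat R)) by exact: Ck_on_cst.
have CN := Ck_on_scale oU (@Ck_on_cst _ _ _ k U (cos tau - 1 : R^o)) (sN k).
have CL := Ck_onD oU Cc CN.
exact: (Ck_on_qmul oU (smooth_P k) (Ck_on_qmul oU CL (smooth_slice It k))).
Qed.

End Deformation.
(* A = dH (cos s - N sin s) comes from d f^alpha and B = dH (Kt N s) from
   d alpha; since (cos s - 1) A + sin s B = (1 - cos s) dH, the smoothness of
   dH follows from that of the parallel sections, except that for cos s = 1
   one has A = dH. *)
Lemma smooth_derive_H (X : R * R) : smooth_on U ('D_X H).
Proof.
pose A z := G (s, z) * 'D_X fa z * P z.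
pose B z := - 2 *: ('D_X (fun y => G (s, y)) z * P z).
have AE z : U z -> A z = 'D_X H z * cplx (N z) (cos s) (- sin s).
  move=> Uz; rewrite /A derive_fa // -!mulrA GP // mulr1.
  by rewrite (mulrA (G _)) GP // mul1r.
have BE z : U z -> B z = 'D_X H z * Kt (N z) s.
  move=> Uz; rewrite /B (eqG X slice_center Uz) mulNr scalerN qscalel -!mulrA GP //.
  by rewrite mulr1 scalerA -scaleNr -mulNr opprK mulfV // scale1r.
have sA : smooth_on U A.
  move=> k; have C1 := smooth_slice slice_center k.
  exact: (Ck_on_qmul oU (Ck_on_qmul oU C1 (smooth_on_derive X smooth_fa k)) (smooth_P k)).
have sB : smooth_on U B.
  move=> k; have C1 := smooth_on_derive X (smooth_slice slice_center) k.
  exact: (Ck_on_scale oU (@Ck_on_cst _ _ _ k U (- 2 : R^o))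
    (Ck_on_qmul oU C1 (smooth_P k))).
have [c1|c1] := eqVneq (cos s) 1.
  have s0 : sin s = 0.
    by apply/eqP; rewrite -sqrf_eq0 sin2cos2 c1 expr1n subrr.
  move=> k; apply: Ck_on_eq (sA k) => // z Uz; rewrite AE //.
  by rewrite /cplx c1 s0 oppr0 scale0r addr0 scale1r mulr1.
pose r : R := (1 - cos s)^-1.
have C k := Ck_on_scale oU (@Ck_on_cst _ _ _ k U (r : R^o))
  (Ck_onD oU (Ck_on_scale oU (@Ck_on_cst _ _ _ k U (cos s - 1 : R^o)) (sA k))
    (Ck_on_scale oU (@Ck_on_cst _ _ _ k U (sin s : R^o)) (sB k))).
move=> k; apply: Ck_on_eq (C k) => // z Uz.
rewrite AE // BE // -!qscaler -mulrDr -qscaler !cplxZ cplxD cplxZ.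
have cs : cos s ^+ 2 = 1 - sin s ^+ 2 by rewrite cos2sin2.
have -> : cplx (N z) (r * ((cos s - 1) * cos s + sin s * sin s))
    (r * ((cos s - 1) * - sin s + sin s * (cos s - 1))) = 1.
  rewrite -[RHS]scale1r (cplx_real (N z)); congr (cplx (N z) _ _); last by ring.
  have -> : (cos s - 1) * cos s + sin s * sin s = 1 - cos s by ring: cs.
  by rewrite mulVf // subr_eq0 eq_sym.
by rewrite mulr1.
Qed.

End LocalCalculus.

(** * Pulling a surface back to the universal cover *)

Section Pullback.
Variable R : realType.

Lemma rotJ_e1 : rotJ ((1, 0) : R * R) = (0, 1).
Proof. by rewrite /rotJ /= oppr0. Qed.

(* [holomorphic_on] only provides one derivative.  Instead of Cauchy's theory,
   smoothness of phi is obtained from that of dF, where F = f \o phi and f is a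
   conformal immersion: with f1 and f2 the partial derivatives of f, the
   derivative of phi is <dF, f1 \o phi> / |f1 \o phi|^2 and
   <dF, f2 \o phi> / |f1 \o phi|^2, which is of class C^k if phi is. *)
Section Bootstrap.
Variables (A B : set (R * R)) (phi : R * R -> R * R) (f N F : R * R -> quat R).
Hypothesis oA : open A.
Hypothesis AB : forall z, A z -> B (phi z).
Hypothesis hphi : holomorphic_on A phi.
Hypothesis sf : smooth_on B f.
Hypothesis N_im : forall w, B w -> qco (N w) 0 = 0 /\ qnorm2 (N w) = 1.
Hypothesis f_conf : forall w X, B w -> 'D_(rotJ X) f w = N w * 'D_X f w.
Hypothesis f_imm : forall w, B w -> 'D_(1, 0) f w != 0.
Hypothesis FE : forall z, A z -> F z = f (phi z).
Hypothesis sF : forall X, smooth_on A ('D_X F).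

Let f1 := 'D_(1, 0) f.
Let f2 := 'D_(0, 1) f.

Lemma derive_pullback z X : A z -> 'D_X F z = 'D_('D_X phi z) f (phi z).
Proof.
move=> Az; have [dphi _] := hphi Az.
have df : differentiable f (phi z) by exact: smooth_on_differentiable sf (AB Az).
rewrite -(derive_comp_plane X dphi df); apply: near_eq_derive.
have : \forall y \near z, A y by exact: open_nbhs_nbhs.
by apply: filterS => y; exact: FE.
Qed.

Lemma derive_rot z X : A z -> 'D_(rotJ X) phi z = rotJ ('D_X phi z).
Proof. by move=> Az; have [dphi J] := hphi Az; rewrite !deriveE // J. Qed.

(** Since f2 = N f1 with N a unit imaginary quaternion, f1 and f2 are orthogonal of equal length;
    the real part of a product with a conjugate is the Euclidean inner product. *)
Lemma re_frame w (x y : R) : B w ->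
  qco ((x *: f1 w + y *: f2 w) * qconj (f1 w)) 0 = x * qnorm2 (f1 w) /\
  qco ((x *: f1 w + y *: f2 w) * qconj (f2 w)) 0 = y * qnorm2 (f1 w).
Proof.
move=> Bw; have -> : f2 w = N w * f1 w by rewrite /f2 -rotJ_e1 f_conf.
have [N0 N1] := N_im Bw; move: (f1 w) (N w) N0 N1 => a n n0 n1.
split.
  rewrite mulrDl !qscalel -mulrA qmul_conj mulq_real.
  by rewrite !(qcoD, qcoZ, qco1, n0, mulr0, addr0, mulr1).
rewrite qconjM mulrDl !qscalel -(mulrA n a) !(mulrA a) qmul_conj !qscalel mul1r.
rewrite qscaler qmul_conj n1 !(qcoD, qcoZ, qco1, qco_conj, n0, mulr0, add0r, mulr1).
by [].
Qed.

Lemma bootstrap k : Ck_on k A phi.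
Proof.
have dphi z : A z -> differentiable phi z by move=> /hphi[].
have f1n0 z : A z -> qco (f1 (phi z) * qconj (f1 (phi z))) 0 != 0.
  move=> Az; rewrite qmul_conj qcoZ qco1 mulr1 qnorm2_eq0.
  exact: f_imm (AB Az).
elim: k => [|k IHk]; first by move=> z /dphi; exact: differentiable_continuous.
split=> // v.
pose x z := ('D_(1, 0) phi z).1; pose y z := ('D_(1, 0) phi z).2.
have C1 : Ck_on k A (fun z => f1 (phi z)).
  exact: (Ck_on_comp_plane oA AB IHk (smooth_on_derive _ sf k)).
have C2 : Ck_on k A (fun z => f2 (phi z)).
  exact: (Ck_on_comp_plane oA AB IHk (smooth_on_derive _ sf k)).
have Ci := Ck_on_inv oA f1n0 (Ck_on_qco oA 0 (Ck_on_qmul oA C1 (Ck_on_qconj oA C1))).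
have FD z : A z -> 'D_(1, 0) F z = x z *: f1 (phi z) + y z *: f2 (phi z).
  move=> Az; rewrite derive_pullback // derive_basis //.
  exact: smooth_on_differentiable sf (AB Az).
have nE z : qco (f1 (phi z) * qconj (f1 (phi z))) 0 = qnorm2 (f1 (phi z)).
  by rewrite qmul_conj qcoZ qco1 mulr1.
have Cx : Ck_on k A (x : _ -> R^o).
  apply: Ck_on_eq (Ck_on_scale oA
    (Ck_on_qco oA 0 (Ck_on_qmul oA (sF (1, 0) k) (Ck_on_qconj oA C1))) Ci) => // z Az.
  have q0 : qnorm2 (f1 (phi z)) != 0 by rewrite -nE; exact: f1n0.
  have E := (re_frame (x z) (y z) (AB Az)).1; rewrite -(FD z Az) in E.
  by rewrite [X in X *: _]E (nE z); exact: (mulfK q0 (x z)).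
have Cy : Ck_on k A (y : _ -> R^o).
  apply: Ck_on_eq (Ck_on_scale oA
    (Ck_on_qco oA 0 (Ck_on_qmul oA (sF (1, 0) k) (Ck_on_qconj oA C2))) Ci) => // z Az.
  have q0 : qnorm2 (f1 (phi z)) != 0 by rewrite -nE; exact: f1n0.
  have E := (re_frame (x z) (y z) (AB Az)).2; rewrite -(FD z Az) in E.
  by rewrite [X in X *: _]E (nE z); exact: (mulfK q0 (y z)).
have Cc (c : R) : Ck_on k A (fun=> c : R^o) by exact: Ck_on_cst.
(* By the Cauchy-Riemann equations the second partial derivative of phi is (-y, x), so x and y
   control all directions. *)
have Ca := Ck_onD oA (Ck_on_scale oA (Cc v.1) Cx) (Ck_on_scale oA (Cc (- v.2)) Cy).
have Cb := Ck_onD oA (Ck_on_scale oA (Cc v.1) Cy) (Ck_on_scale oA (Cc v.2) Cx).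
apply: Ck_on_eq (Ck_on_pair oA Ca Cb) => // z Az.
rewrite [RHS]derive_basis; last exact: dphi.
rewrite -rotJ_e1 derive_rot // /rotJ -/(x z) -/(y z).
by congr pair; rewrite /= /GRing.scale /= ?mulNr ?mulrN.
Qed.

End Bootstrap.
Lemma cinvK (T : topologicalType) (u : chart R T) z : is_chart u -> cimg u z ->
  cdom u (cinv u z) /\ cmap u (cinv u z) = z.
Proof. by move=> [_ _ K _ _] [p up <-]; rewrite K. Qed.

Lemma imag_unit_sqr (x : quat R) : unit_sphere x -> x * x = -1.
Proof.
move=> [/= x0 x1]; have : x * qconj x = 1 by rewrite qmul_conj x1 scale1r.
have -> : qconj x = - x.
  by apply: quatP; rewrite !qsimp // x0 oppr0.
by rewrite mulrN => <-; rewrite opprK.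
Qed.

Section Surfaces.
Variables (M S : topologicalType) (atM : set (chart R M)) (atS : set (chart R S)).
Variables (pi : S -> M) (f N : M -> quat R).
Hypothesis rM : riemann_surface atM.
Hypothesis rS : riemann_surface atS.
Hypothesis cpi : continuous pi.
Hypothesis hpi : holomorphic_map atS atM pi.
Hypothesis cmc : cmc_surface atM f N.

Lemma local_expression u z : atS u -> cimg u z -> exists v D phi,
  [/\ atM v, open D, D z, D `<=` cimg u & [/\ holomorphic_on D phi,
    (forall y, D y -> cimg v (phi y)) &
    (forall y, D y -> cinv v (phi y) = pi (cinv u y))]].
Proof.
move=> uS uz; have cu := rs_chart rS uS.
have [v vM vp] := rs_cover rM (pi (cinv u z)); have cv := rs_chart rM vM.
have [_ oimg K _ cinvc] := cu; have [odom _ vK _ _] := cv.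
pose D := cmap u @` (cdom u `&` pi @^-1` cdom v).
have OE y : D y <-> cimg u y /\ cdom v (pi (cinv u y)).
  split=> [[p [up vp']] <-|[uy vy]]; first by split; [exists p|rewrite K].
  by have [dy yE] := cinvK cu uy; exists (cinv u y).
have Osub : D `<=` cimg u by move=> y /OE[].
exists v, D, (cmap v \o pi \o cinv u); split=> //; last split.
- rewrite openE => y /OE[uy vy].
  have n1 : \forall t \near y, cimg u t by exact: open_nbhs_nbhs.
  have n2 : \forall t \near y, cdom v (pi (cinv u t)).
    have c : {for y, continuous (pi \o cinv u)}.
      by apply: continuous_comp; [exact: cinvc|exact: cpi].
    by apply: (c (cdom v)); exact: open_nbhs_nbhs.
  by rewrite /interior /=; near=> t; apply/OE; split; near: t.
- by apply/OE.
- exact: hpi.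
- by move=> y /OE[_ vy]; exists (pi (cinv u y)).
- by move=> y /OE[_ vy] /=; exact: vK.
Unshelve. all: by end_near. Qed.

(** Only first-order facts are transferred to the cover: they need a single derivative of pi, which
    is all that is known at this stage. *)
Lemma pullback_gauss u z X : atS u -> cimg u z ->
  [/\ differentiable ((N \o pi) \o cinv u) z,
      qco (dform u (f \o pi) z X) 0 = 0 &
      dform u (f \o pi) z X * (N \o pi) (cinv u z) =
        - ((N \o pi) (cinv u z) * dform u (f \o pi) z X)].
Proof.
move=> uS uz; have [v [D [phi [vM oD Oz Ou [hphi Ov phiE]]]]] := local_expression uS uz.
have [sf imf immf [sN uN cf] cH] := cmc.
have nO : \forall y \near z, D y by exact: open_nbhs_nbhs.
have [dphi _] := hphi z Oz.
have FE y : D y -> (f \o pi) (cinv u y) = (f \o cinv v) (phi y).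
  by move=> Oy /=; rewrite phiE.
have df : differentiable (f \o cinv v) (phi z).
  exact: smooth_on_differentiable (sf v vM) (Ov z Oz).
have dfE : dform u (f \o pi) z X = dform v f (phi z) ('D_X phi z).
  exact: derive_pullback oD Ov hphi (sf v vM) FE z X Oz.
have [c1 c2] := cf v (phi z) ('D_X phi z) vM (Ov z Oz).
split.
- have : differentiable ((N \o cinv v) \o phi) z.
    apply: (differentiable_comp dphi).
    exact: smooth_on_differentiable (sN v vM) (Ov z Oz).
  by apply: near_eq_differentiable; apply: filterS nO => y Oy /=; rewrite phiE.
- rewrite dfE /dform -derive_qco //.
  have -> : (fun y => qco ((f \o cinv v) y) 0 : R^o) = cst 0.
    by apply/funext => y; exact: imf.
  by rewrite derive_cst.
- by rewrite dfE /= -(phiE z Oz) -c1 c2 opprK.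
Qed.

(** The hypothesis on d(f o pi) is what the parallel sections supply through [smooth_derive_H]; it
    makes pi smooth in charts, hence also N o pi. *)
Lemma pullback_smooth : (forall u X, atS u ->
    smooth_on (cimg u) ('D_X ((f \o pi) \o cinv u))) ->
  smooth_map atS (N \o pi).
Proof.
move=> sdf u uS k; apply: Ck_on_local => z uz.
have [v [D [phi [vM oD Oz Ou [hphi Ov phiE]]]]] := local_expression uS uz.
have [sf imf immf [sN uN cf] cH] := cmc.
have FE y : D y -> (f \o pi) (cinv u y) = (f \o cinv v) (phi y).
  by move=> Oy /=; rewrite phiE.
exists D => //.
have Cphi : Ck_on k D phi.
  apply: (@bootstrap D (cimg v) phi (f \o cinv v) (N \o cinv v)
    ((f \o pi) \o cinv u) oD Ov hphi (sf v vM)) => //.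
  - by move=> w _; have [] := uN (cinv v w).
  - by move=> w X vw; have [] := cf v w X vM vw.
  - move=> w vw; apply: immf => //.
    by apply/eqP => -[/eqP]; rewrite oner_eq0.
  - by move=> X k'; exact: Ck_on_sub Ou (sdf u X uS k').
have := Ck_on_comp_plane oD Ov Cphi (sN v vM k).
by apply: Ck_on_eq => // y Oy /=; rewrite phiE.
Qed.

End Surfaces.

End Pullback.

(** * Parallel sections have constant norm *)

Section ParallelNorm.
Variables (R : realType) (T : topologicalType) (at_ : set (chart R T)).
Variables (h N : T -> quat R).
Hypothesis rT : riemann_surface at_.
Hypothesis h_im : forall u z X, at_ u -> cimg u z -> qco (dform u h z X) 0 = 0.
Hypothesis anti : forall u z X, at_ u -> cimg u z ->
  dform u h z X * N (cinv u z) = - (N (cinv u z) * dform u h z X).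

Lemma parallel_derive t a u z X : cmc_parallel at_ h N (qexpi t) a ->
  at_ u -> cimg u z ->
  dform u a z X = - (2^-1 *: (dform u h z X * (Kt (N (cinv u z)) t * a (cinv u z)))).
Proof.
move=> [_ pa] tu uz; have := pa u z X tu uz; rewrite /cmc_conn /= conn_coef.
by move/eqP; rewrite addr_eq0 => /eqP.
Qed.

(** The level set of g through p is open and closed in a connected surface. *)
Lemma locally_const_eq (W : eqType) (g : T -> W) :
  (forall p, \forall q \near p, g q = g p) -> forall p q, g q = g p.
Proof.
move=> lg p q; pose A := [set q | g q = g p].
have oA : open A.
  by rewrite openE => r Ar; rewrite /interior /=; apply: filterS (lg r) => r' E; rewrite /A /= E.
have cA : closed A.
  rewrite -[A]setCK; apply: open_closedC; rewrite openE => r Ar.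
  by rewrite /interior /=; apply: filterS (lg r) => r' E; rewrite /A /= E.
suff : A = setT by move=> AT; have : A q by rewrite AT.
apply: (rs_connected rT); first by exists p.
  by exists A; rewrite ?setTI.
by exists A; rewrite ?setTI.
Qed.

Lemma chart_near u p (Q : T -> Prop) : at_ u -> cdom u p ->
  (\forall z \near cmap u p, Q (cinv u z)) -> \forall q \near p, Q q.
Proof.
move=> tu up nQ; have [odom _ K cm _] := rs_chart rT tu.
have n1 : \forall q \near p, cdom u q by exact: open_nbhs_nbhs.
have n2 : \forall q \near p, Q (cinv u (cmap u q)) 
  by exact: (cm p up (fun z => Q (cinv u z)) nQ).
near=> q; have <- : cinv u (cmap u q) = q by apply: K; near: q.
by near: q.
Unshelve. all: by end_near. Qed.

(* On the unit circle the connection is unitary: dh and dh N are imaginary,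
   hence so is dh (Kt N t). *)
Lemma parallel_norm t a : cmc_parallel at_ h N (qexpi t) a ->
  forall p q, qnorm2 (a q) = qnorm2 (a p).
Proof.
move=> pa; apply: locally_const_eq => p.
have [u tu up] := rs_cover rT p; have [odom oimg K cm ci] := rs_chart rT tu.
apply: (chart_near tu up).
pose b := a \o cinv u.
have sb : smooth_on (cimg u) b by have [sa _] := pa; exact: sa.
have nE x : qnorm2 x = qco (x * qconj x) 0.
  by rewrite qmul_conj qcoZ qco1 mulr1.
have db z : cimg u z -> differentiable b z by exact: smooth_on_differentiable.
have dcb z : cimg u z -> differentiable (fun y => qconj (b y)) z.
  by move=> uz; have [+ _] := Ck_on_qconj oimg (sb 1%N); exact.
have dM z : cimg u z -> differentiable (fun y => b y * qconj (b y)) z.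
  by move=> uz; exact: (differentiable_qmul (db z uz) (dcb z uz)).
have d0 z : cimg u z -> differentiable (fun y => qco (b y * qconj (b y)) 0 : R^o) z.
  move=> uz; have C := Ck_on_qco oimg 0 (Ck_on_qmul oimg (sb 1%N) (Ck_on_qconj oimg (sb 1%N))).
  by have [+ _] := C; exact.
have D0 z X : cimg u z -> 'D_X (fun y => qco (b y * qconj (b y)) 0 : R^o) z = 0.
  move=> uz; rewrite (derive_qco 0 X (dM z uz)) (derive_qmul X (db z uz) (dcb z uz)).
  rewrite (derive_qconj X (db z uz)).
  have -> : 'D_X b z = - (2^-1 *: (dform u h z X * (Kt (N (cinv u z)) t * b z))).
    exact: parallel_derive pa tu uz.
  set d := dform _ _ _ _; set n := N _; set w := b z.
  have d_re : qco d 0 = 0 by exact: h_im.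
  have dn_re : qco (d * n) 0 = 0.
    have E : qco (d * n) 0 = - qco (d * n) 0.
      by rewrite {2}(re_mulC d n) -qcoN; congr (qco _ 0); exact: anti.
    by lra.
  have m_re : qco (d * Kt n t) 0 = 0.
    by rewrite /Kt /cplx mulrDr mulq_real qscaler !(qcoD, qcoZ) d_re dn_re !mulr0 addr0.
  have re_conj x : qco (qconj x) 0 = qco x 0 by rewrite qco_conj.
  have -> : w * qconj (- (2^-1 *: (d * (Kt n t * w)))) =
      qconj (- (2^-1 *: (d * (Kt n t * w))) * qconj w).
    rewrite [RHS]qconjM; congr (_ * _); apply: quatP; rewrite !qco_conj ?opprK //.
  rewrite qcoD re_conj mulNr qscalel -!mulrA qmul_conj mulq_real qscaler.
  by rewrite qcoN !qcoZ m_re !mulr0 oppr0 addr0.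
have pz : cimg u (cmap u p) by exists p.
have := locally_constant oimg pz d0 D0.
by apply: filterS => z; rewrite -!nE /b /= K.
Qed.

End ParallelNorm.

(** * Frames of the constrained Willmore connections *)

Section Frame.
Variables (R : realType) (T : topologicalType) (at_ : set (chart R T)).

Lemma ord2P (i : 'I_2) : i = 0 \/ i = 1.
Proof. by case: i => [[|[|//]] hi]; [left|right]; apply/val_inj. Qed.

Lemma lift2 : lift ord0 ord0 = 1 :> 'I_2.
Proof. exact: val_inj. Qed.

Lemma mulmx_real (x y q : quat R) : colq x y *m q%:M = colq (x * q) (y * q).
Proof.
apply/colP => i; rewrite !mxE big_ord1 !mxE eqxx mulr1n.
by case: ifP.
Qed.

Lemma cw_parallel_colq h N l (x y : T -> quat R) : smooth_map at_ x -> smooth_map at_ y ->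
  (forall u z X, at_ u -> cimg u z ->
    let p := cinv u z in
    let B := 2^-1 *: (dform u (fun p' => h p' + N p') z X *
      (- (N p * y p * (acoef l - 1)) + y p * bcoef l)) in
    dform u x z X + h p * B = 0 /\ dform u y z X + B = 0) ->
  cw_parallel at_ h N l (fun p => colq (x p) (y p)).
Proof.
move=> sx sy hB.
have E0 : (fun p => colq (x p) (y p) 0 0) = x by apply/funext => p; rewrite mxE.
have E1 : (fun p => colq (x p) (y p) 1 0) = y by apply/funext => p; rewrite mxE.
split=> [i|u z X tu uz].
  by have [->|->] := ord2P i; rewrite ?E0 ?E1.
rewrite /cw_conn /psi mulmx_real mul1r.
have [h0 h1] := hB u z X tu uz.
apply/colP => i; have [->|->] := ord2P i.
- by rewrite !mxE /= E0; exact: h0.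
- by rewrite !mxE /= E1; exact: h1.
Qed.

(** Upper triangular, with columns e and (w, b): such matrices are closed under products, so the
    inverse is explicit and invertibility is b != 0. *)
Definition frame (w b : quat R) : 'M[quat R]_2 :=
  \matrix_(i, j) (if j == 0 then colq 1 0 else colq w b) i 0.

Lemma mul_frame w b (v : 'cV[quat R]_2) :
  frame w b *m v = colq (v 0 0 + w * v 1 0) (b * v 1 0).
Proof.
apply/colP => i; rewrite !mxE !big_ord_recl big_ord0 lift2 !mxE.
by have [->|->] := ord2P i; rewrite ?(mxE, mul1r, mul0r, addr0, add0r).
Qed.

Lemma mul_frames w b w' b' :
  frame w b *m frame w' b' = frame (w' + w * b') (b * b').
Proof.
apply/matrixP => i j; rewrite !mxE !big_ord_recl big_ord0 lift2 !mxE.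
by have [->|->] := ord2P i; have [->|->] := ord2P j;
  rewrite /= !mxE /= ?(mul1r, mulr1, mul0r, mulr0, addr0, add0r).
Qed.

Lemma frame1 : frame 0 1 = 1%:M.
Proof.
apply/matrixP => i j.
by have [->|->] := ord2P i; have [->|->] := ord2P j; rewrite !mxE /= ?mxE.
Qed.

Lemma frame_invertible w b : b != 0 -> mx_invertible (frame w b).
Proof.
move=> b0; exists (frame (- (w * b^-1)) b^-1).
split; rewrite mul_frames -frame1 ?qmulV ?qmulVl //; first by rewrite addNr.
by rewrite mulNr -mulrA qmulVl // mulr1 subrr.
Qed.

Lemma colq_inj x y x' y' : colq x y = colq x' y' :> 'cV[quat R]_2 -> x = x' /\ y = y'.
Proof. by move=> /colP E; have := E 0; have := E 1; rewrite !mxE. Qed.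

(** For v = (v0, v1), membership means v0 + w v1 = h b v1, that is, v0 = a v1. *)
Lemma frame_preimage h w b a : b != 0 -> w = h * b - a ->
  mulmx (frame w b) @^-1` qline (colq h 1) = qline (colq a 1).
Proof.
move=> b0 ->; apply/seteqP; split=> v /=; rewrite /qline /=.
  move=> [q _]; rewrite mulmx_real mul1r mul_frame => /colq_inj[E0 qE].
  exists (v 1 0) => //; rewrite mulmx_real mul1r.
  apply/colP => i; have [->|->] := ord2P i; rewrite mxE //=.
  move: E0; rewrite qE mulrA mulrBl => E0.
  by rewrite -(addrK (h * b * v 1 0 - a * v 1 0) (v 0 0)) -E0 opprB addrC subrK.
move=> [q _ <-]; exists (b * q) => //.
by rewrite !mulmx_real mul_frame !mxE /= !mul1r mulrBl mulrA addrC subrK.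
Qed.

End Frame.

(** * Locally uniform convergence *)

Section Convergence.
Variable R : realType.

(** The estimate is joint in the point and the index, which is the form that the covering
    characterization of compactness turns into one bound on all of K. *)
Lemma family_compact_cvg (T : topologicalType) (V : normedModType R) (I : Type)
  (F : set_system I) (A : I -> T -> V) (g : T -> V) : Filter F ->
  (forall (p : T) (e : R), 0 < e -> \forall q \near p & i \near F, `|g q - A i q| <= e) ->
  {family compact, A @ F --> g}.
Proof.
move=> FF cvg; apply/fam_cvgP => K cK Q /uniform_nbhs[E [entE EQ]].
have := entE; rewrite -entourage_ballE => -[e /= e0 eE].
have e2 : 0 < e / 2 by rewrite divr_gt0.
have nK : \forall i \near F, K `<=` (fun q => `|g q - A i q| <= e / 2).
  by move/compact_near_coveringP : cK; apply => // q _; exact: cvg.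
rewrite /nbhs /=; apply: filterS nK => i iK; apply: EQ => q Kq.
apply: eE => /=; rewrite -ball_normE /=.
by rewrite (le_lt_trans (iK q Kq)) // ltr_pdivrMr // ltr_pMr // ltr1n.
Qed.

Lemma quat_norm_le (x : quat R) e : 0 <= e ->
  `|qco x 0| <= e -> `|qco x 1| <= e -> `|qco x 2| <= e -> `|qco x 3| <= e ->
  `|x| <= e.
Proof.
move=> e0 h0 h1 h2 h3.
rewrite /Num.Def.normr/= mx_normrE (bigmax_le _ e0)//= => -[i j] _ /=.
rewrite (ord1 i) -[j]inord_val.
by case: j => [[|[|[|[|]]]]] //= _.
Qed.

(** In each coordinate the quotient equals the t-derivative at some s + c with |c| <= |t|. Here c
    depends on y, but joint continuity of that derivative gives a bound uniform in y near z. *)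
Lemma difference_quotient (V : normedModType R) (B : set (R * V)) (G : R * V -> quat R) s z :
  open B -> B (s, z) -> smooth_on B G -> forall e, 0 < e ->
  \forall y \near z & t \near 0^',
    `|'D_(1, 0) G (s, y) - t^-1 *: (G (s + t, y) - G (s, y))| <= e.
Proof.
move=> oB Bsz sG e e0.
have key n : \forall y \near z & t \near 0^',
    `|qco ('D_(1, 0) G (s, y) - t^-1 *: (G (s + t, y) - G (s, y))) n| <= e.
  pose g := (fun p => qco (G p) n : R^o).
  have Cg k : Ck_on k B g by exact: (Ck_on_qco oB n (sG k)).
  have dg p : B p -> differentiable g p by have [+ _] := Cg 1%N; exact.
  have cDg : {for (s, z), continuous ('D_(1, 0) g)}.
    by have [_ /(_ (1, 0))] := Cg 1%N; exact.
  have nDg : nbhs (s, z) [set p | B p /\ `|'D_(1, 0) g (s, z) - 'D_(1, 0) g p| <= e / 2].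
    apply: filterI; first exact: open_nbhs_nbhs.
    by move/cvgrPdist_le : cDg; apply; rewrite divr_gt0.
  have [[Q1 Q2] [/= /nbhs_ballP[d /= d0 dQ1] nQ2] QB] := nDg.
  exists (Q2, [set t | t != 0 /\ `|t| < d]).
    split=> //=; apply/nbhs_ballP; exists d => // t.
    by rewrite -ball_normE /= sub0r normrN.
  move=> [y t] /= [Qy [t0 td]].
  have lineE (c : R) : (s, y) + c *: ((1, 0) : R * V) = (s + c, y).
    by congr pair; rewrite /= ?[c *: 1]mulr1 ?scaler0 ?addr0.
  have Bl (c : R) : `|c| <= `|t| ->
      B (s + c, y) /\ `|'D_(1, 0) g (s, z) - 'D_(1, 0) g (s + c, y)| <= e / 2.
    move=> ct; apply: (QB (s + c, y)); split=> //=; apply: dQ1.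
    by rewrite -ball_normE /= opprD addNKr normrN (le_lt_trans ct).
  have [c ct|c ct gE] := @mvt_line R _ g (s, y) (1, 0) t.
    by rewrite lineE; apply: dg; have [] := Bl c ct.
  have [_ b1] := Bl c ct.
  have [B0 b2] : B (s, y) /\ `|'D_(1, 0) g (s, z) - 'D_(1, 0) g (s, y)| <= e / 2.
    by have := Bl 0; rewrite addr0 normr0; apply.
  have -> : qco ('D_(1, 0) G (s, y) - t^-1 *: (G (s + t, y) - G (s, y))) n =
     'D_(1, 0) g (s, y) - 'D_(1, 0) g (s + c, y).
    have dG : differentiable G (s, y) by exact: smooth_on_differentiable sG B0.
    rewrite !lineE in gE; have Dq := derive_qco n ((1, 0) : R * V) dG.
    rewrite qcoD qcoN qcoZ qcoD qcoN; congr (_ - _); first exact: esym Dq.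
    by rewrite -[X in _ * X]/(g (s + t, y) - g (s, y)) gE mulKf.
  rewrite (splitr e) -(subrKA ('D_(1, 0) g (s, z))) (le_trans (ler_normD _ _)) //.
  by rewrite lerD // distrC.
apply: filterS (filterI (filterI (key 0) (key 1)) (filterI (key 2) (key 3))).
by move=> [y t] /= [[h0 h1] [h2 h3]]; apply: quat_norm_le; rewrite // ltW.
Unshelve. all: by end_near. Qed.

End Convergence.

(** * The angle of lambda near 1 on the unit circle *)

Section Angle.
Variable R : realType.

(** A branch of the argument, correct on the half of the unit circle with positive real part. Its
    values elsewhere are immaterial to a limit at 1. *)
Definition angle (l : quat R) : R := asin (qco l 1).

Lemma angle_cvg0 : {for (1 : quat R), continuous angle}.
Proof.
have q0 : qco (1 : quat R) 1 = 0 by rewrite qco1.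
apply: (@continuous_comp _ _ _ (@qcoord R 1) (@asin R)).
  exact: qcoord_continuous.
by apply: continuous_asin; rewrite /qcoord q0 ltrN10 ltr01.
Qed.

Lemma angle1 : angle 1 = 0.
Proof.
have h : (0 : R) \in `[- (pi / 2), pi / 2].
  by rewrite in_itv /= oppr_le0 divr_ge0 ?pi_ge0.
by rewrite /angle qco1 -{1}sin0 sinK.
Qed.

Lemma circle_to_1_angle : \forall l \near circle_to_1 R,
  l = qexpi (angle l) /\ cos (angle l) != 1.
Proof.
have pos : \forall l \near (1 : quat R), 0 < qco l 0.
  have c : {for (1 : quat R), continuous (@qcoord R 0)} by exact: qcoord_continuous.
  by apply: (c [set r | 0 < r]); rewrite /qcoord qco1; apply: lt_nbhsr.
rewrite /circle_to_1 /within /=; apply: filterS pos => l l0 [[l2 l3 l1] ln1].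
have l01 : qco l 0 ^+ 2 = 1 - qco l 1 ^+ 2.
  by rewrite -l1 /qnorm2 l2 l3; ring.
have bnd : -1 <= qco l 1 <= 1.
  by rewrite -ler_norml -(@ler_pXn2r _ 2) ?nnegrE // expr1n real_normK ?num_real //
     -subr_ge0 -l01 sqr_ge0.
have lE : l = qexpi (angle l).
  rewrite /qexpi /angle cos_asin // -l01 sqrtr_sqr gtr0_norm // asinK ?in_itv //.
  by apply: quatP; rewrite !qco_mkq.
split=> //; apply/eqP => c1; apply: ln1.
have s0 : sin (angle l) = 0.
  by apply/eqP; rewrite -sqrf_eq0 sin2cos2 c1 expr1n subrr.
by rewrite /= lE /qexpi c1 s0; apply: quatP; rewrite !(qco_mkq, qco1).
Qed.

Global Instance circle_to_1_filter : Filter (circle_to_1 R).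
Proof. exact: within_filter. Qed.

(** The limit has to be punctured because tau = [angle l] is the denominator of the difference
    quotient. *)
Lemma angle_dnbhs : angle @ circle_to_1 R --> 0^'.
Proof.
move=> Q /= nQ; have n1 : \forall l \near circle_to_1 R, angle l != 0 -> Q (angle l).
  have c : angle l @[l --> (1 : quat R)] --> (0 : R) by rewrite -angle1; exact: angle_cvg0.
  by apply: cvg_within; exact: (c (fun t => t != 0 -> Q t) nQ).
suff : \forall l \near circle_to_1 R, Q (angle l) by [].
apply: filterS (filterI n1 circle_to_1_angle) => l [h [_ c1]].
by apply: h; apply: contra c1 => /eqP ->; rewrite cos0.
Qed.

End Angle.

(** * The limit of the associated family *)

Section AssociatedFamily.
Variables (R : realType) (M S : topologicalType).
Variables (atM : set (chart R M)) (atS : set (chart R S)) (pi : S -> M).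
Variables (f N : M -> quat R) (s e : R) (alphat : R -> S -> quat R) (c0 : R).

Let I : set R := `]s - e, s + e[.
Let h := f \o pi.
Let n := N \o pi.

Hypothesis rM : riemann_surface atM.
Hypothesis rS : riemann_surface atS.
Hypothesis cpi : continuous pi.
Hypothesis hpi : holomorphic_map atS atM pi.
Hypothesis cmc : cmc_surface atM f N.
Hypothesis e0 : 0 < e.
Hypothesis sG : forall u, atS u -> smooth_on (I `*` cimg u)
  (fun tz : R * (R * R) => alphat tz.1 (cinv u tz.2)).
Hypothesis par : forall t, I t -> cmc_parallel atS h n (qexpi t) (alphat t).
Hypothesis c00 : c0 != 0.
Hypothesis nrm : forall p, qnorm2 (alphat s p) = c0.

Let fa := sym_bobenko s alphat.
Let Na := sym_bobenko_gauss n (alphat s).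

Let P p := (alphat s p)^-1.

Section Chart.
Variable u : chart R S.
Hypothesis uS : atS u.

Let U := cimg u.
Let G (tz : R * (R * R)) := alphat tz.1 (cinv u tz.2).

Lemma open_cimg : open U.
Proof. by have [] := rs_chart rS uS. Qed.

Lemma gauss_sqr z : U z -> (n \o cinv u) z * (n \o cinv u) z = -1.
Proof. by move=> _; apply: imag_unit_sqr; have [_ _ _ [_ uN _] _] := cmc; exact: uN. Qed.

Lemma gauss_diff z : U z -> differentiable (n \o cinv u) z.
Proof. by move=> uz; have [] := pullback_gauss rM rS cpi hpi cmc 0 uS uz. Qed.

Lemma gauss_anti z (X : R * R) : U z ->
  'D_X (h \o cinv u) z * (n \o cinv u) z = - ((n \o cinv u) z * 'D_X (h \o cinv u) z).
Proof. by move=> uz; have [_ _] := pullback_gauss rM rS cpi hpi cmc X uS uz. Qed.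

Lemma slice_eq t z (X : R * R) : I t -> U z ->
  'D_X (fun y => G (t, y)) z =
  - (2^-1 *: ('D_X (h \o cinv u) z * (Kt ((n \o cinv u) z) t * G (t, z)))).
Proof. by move=> It uz; exact: (parallel_derive X (par It) uS uz). Qed.

Lemma slice_norm z : U z -> qnorm2 (G (s, z)) = c0.
Proof. by move=> _; exact: nrm. Qed.

Lemma chart_P : P \o cinv u = (fun z => c0^-1 *: qconj (G (s, z))).
Proof. by apply/funext => z; rewrite /= /P qinvE nrm. Qed.

Lemma chart_fa : fa \o cinv u =
  (fun z => - 2 *: ((P \o cinv u) z * 'D_(1, 0) G (s, z))).
Proof.
apply/funext => z; rewrite /= /fa /sym_bobenko; congr (_ *: (_ * _)).
by rewrite derive1E -derive_slice1.
Qed.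

Lemma chart_Na : Na \o cinv u =
  (fun z => (P \o cinv u) z * (n \o cinv u) z * G (s, z)).
Proof. by []. Qed.

Lemma chart_smooth_fa : smooth_on U (fa \o cinv u).
Proof. exact: (smooth_fa open_cimg e0 (sG uS) chart_P erefl chart_fa). Qed.

Lemma chart_smooth_dh (X : R * R) : smooth_on U ('D_X (h \o cinv u)).
Proof.
exact: (smooth_derive_H open_cimg e0 (sG uS) slice_eq c00 slice_norm chart_P
  erefl chart_fa).
Qed.

End Chart.

Lemma smooth_gauss : smooth_map atS n.
Proof.
apply: (pullback_smooth rM rS cpi hpi cmc) => u X uS.
exact: chart_smooth_dh.
Qed.

Section Member.
Variable tau : R.
Hypothesis It : I (s + tau).
Hypothesis ctau : cos tau != 1.
Hypothesis nz : forall p, alphat (s + tau) p != 0.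

(* In the notation of the file header, [deformation] is alpha', its dual is
   beta, and [member] is -2 (alpha' - 1) / tau. *)
Definition deformation p := P p * alphat (s + tau) p.
Definition deformation_dual p := P p * (Kt (n p) tau * alphat (s + tau) p).
Definition member p := (- 2 / tau) *: (deformation p - 1).

Let b p := tau^-1 *: deformation_dual p.
Let w p := fa p * b p - member p.

Lemma chart_smooth_deformation u : atS u -> smooth_on (cimg u) (deformation \o cinv u).
Proof.
move=> uS.
exact: (smooth_al (open_cimg uS) e0 (sG uS) (chart_P u) It erefl erefl).
Qed.

Lemma chart_smooth_weight u : atS u -> smooth_on (cimg u) (b \o cinv u).
Proof.
move=> uS k; have C := smooth_be (open_cimg uS) e0 (sG uS) (chart_P u) It
  erefl erefl erefl (smooth_gauss uS) k.
exact: (Ck_on_scale (open_cimg uS) (@Ck_on_cst _ _ _ k (cimg u) (tau^-1 : R^o)) C).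
Qed.

Lemma chart_smooth_member u : atS u -> smooth_on (cimg u) (member \o cinv u).
Proof.
move=> uS k; have C := Ck_onD (open_cimg uS) (chart_smooth_deformation uS k)
  (@Ck_on_cst _ _ _ k (cimg u) (- 1 : quat R)).
exact: (Ck_on_scale (open_cimg uS) (@Ck_on_cst _ _ _ k (cimg u) (- 2 / tau : R^o)) C).
Qed.

Lemma chart_smooth_entry u : atS u -> smooth_on (cimg u) (w \o cinv u).
Proof.
move=> uS k; have ou := open_cimg uS.
have Cm : Ck_on k (cimg u) (fun z => (- 1) *: (member \o cinv u) z).
  exact: (Ck_on_scale ou (@Ck_on_cst _ _ _ k (cimg u) (- 1 : R^o)) (chart_smooth_member uS k)).
have := Ck_onD ou (Ck_on_qmul ou (chart_smooth_fa uS k) (chart_smooth_weight uS k)) Cm.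
by apply: Ck_on_eq => // z uz; rewrite scaleN1r.
Qed.

(** The squared norm of [Kt (n p) tau] is 2 (1 - cos tau), which vanishes exactly at lambda = 1;
    away from it the frame is invertible. *)
Lemma weight_neq0 p : b p != 0.
Proof.
have tau0 : tau != 0 by apply: contra ctau => /eqP ->; rewrite cos0.
have P0 : P p != 0.
  by rewrite /P invr_eq0 -qnorm2_eq0 nrm.
rewrite scaler_eq0 invr_eq0 (negbTE tau0) /= -qnorm2_eq0 !qnorm2M !mulf_neq0 ?qnorm2_eq0 //.
have uN : qnorm2 (n p) = 1 /\ qco (n p) 0 = 0.
  by have [_ _ _ [_ uN _] _] := cmc; have [] := uN (pi p).
have : qnorm2 (Kt (n p) tau) = 2 * (1 - cos tau).
  have cs : cos tau ^+ 2 = 1 - sin tau ^+ 2 by rewrite cos2sin2.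
  have [n1 n0] := uN; move: n1; rewrite /Kt /cplx /qnorm2 !qsimp n0 => n1.
  have n1' : qco (n p) 1 ^+ 2 = 1 - qco (n p) 2 ^+ 2 - qco (n p) 3 ^+ 2 by rewrite -n1; ring.
  ring: cs n1'.
move=> E; rewrite -qnorm2_eq0 E mulf_neq0 // ?pnatr_eq0 // subr_eq0 eq_sym //.
Qed.

Lemma derive_deformation u z (X : R * R) : atS u -> cimg u z ->
  'D_X (deformation \o cinv u) z =
  - (2^-1 *: ('D_X (fa \o cinv u) z * (deformation_dual \o cinv u) z)).
Proof.
move=> uS uz.
exact: (derive_al (open_cimg uS) e0 (sG uS) (@gauss_sqr u) (slice_eq uS) c00
  (@slice_norm u) (chart_P u) erefl (chart_fa u) It erefl erefl erefl erefl X uz).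
Qed.

Lemma derive_deformation_dual u z (X : R * R) : atS u -> cimg u z ->
  'D_X (deformation_dual \o cinv u) z =
  - (2^-1 *: ('D_X (fun y => (fa \o cinv u) y + (Na \o cinv u) y) z *
    (cplx ((Na \o cinv u) z) (sin tau) (1 - cos tau) * (deformation_dual \o cinv u) z))).
Proof.
move=> uS uz.
exact: (derive_be (open_cimg uS) e0 (sG uS) (@gauss_sqr u) (gauss_diff uS)
  (gauss_anti uS) (slice_eq uS) c00
  (@slice_norm u) (chart_P u) erefl (chart_fa u) (chart_Na u) It erefl erefl erefl X uz).
Qed.

Lemma cw_parallel_member : cw_parallel atS fa Na (qexpi tau) (fun p => colq (w p) (b p)).
Proof.
apply: cw_parallel_colq.
- exact: chart_smooth_entry.
- exact: chart_smooth_weight.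
move=> u z X uS uz p B.
have ou := open_cimg uS.
have ddual : differentiable (deformation_dual \o cinv u) z.
  have := smooth_be (open_cimg uS) e0 (sG uS) (chart_P u) It
    erefl erefl erefl (smooth_gauss uS).
  by move=> sb; exact: smooth_on_differentiable sb uz.
have ddef := smooth_on_differentiable (chart_smooth_deformation uS) uz.
have dfa := smooth_on_differentiable (chart_smooth_fa uS) uz.
have db := smooth_on_differentiable (chart_smooth_weight uS) uz.
have dm := smooth_on_differentiable (chart_smooth_member uS) uz.
have Db : dform u b z X = tau^-1 *: 'D_X (deformation_dual \o cinv u) z.
  exact: (deriveZ tau^-1 (diff_derivable ddual)).
(* The factors -2 / tau and -1/2 combine to the 1 / tau inside [b]. Hence d(fa b - member) reduces
   to fa db, as the first row of the connection requires. *)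
have Dm : 'D_X (member \o cinv u) z = 'D_X (fa \o cinv u) z * (b \o cinv u) z.
  have dc := differentiable_cst (1 : quat R) z.
  have dd := differentiableB ddef dc.
  have -> : 'D_X (member \o cinv u) z =
    (- 2 / tau) *: ('D_X (deformation \o cinv u) z - 'D_X (cst (1 : quat R)) z).
    rewrite -(deriveB (diff_derivable ddef) (diff_derivable dc)).
    exact: (deriveZ (- 2 / tau) (diff_derivable dd)).
  rewrite derive_cst subr0 derive_deformation // /= /b qscaler scalerN scalerA -scaleNr.
  congr (_ *: _); rewrite -mulNr -mulNr opprK mulrAC mulfV ?mul1r //.
have BE : dform u b z X = - B.
  rewrite Db derive_deformation_dual // scalerN /B conn_coefN; congr (- _).
  rewrite /b /dform !qscaler scalerA [in RHS]scalerA mulrC; congr (_ *: _).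
split; last by rewrite BE addNr.
have dfb := differentiable_qmul dfa db.
have -> : dform u w z X = 'D_X (fun y => (fa \o cinv u) y * (b \o cinv u) y) z -
    'D_X (member \o cinv u) z.
  exact: (deriveB (diff_derivable dfb) (diff_derivable dm)).
rewrite (derive_qmul X dfa db) Dm [X in X - _]addrC addrK.
by rewrite -[X in _ * X + _]/(dform u b z X) BE mulrN addNr.
Qed.

Lemma cw_associated_member :
  cw_associated atS fa Na (qexpi tau) (fun p => frame (w p) (b p)) member.
Proof.
split; last by move=> p; apply: frame_preimage; first exact: weight_neq0.
split=> [p|j]; first exact/frame_invertible/weight_neq0.
have [->|->] := ord2P j.
  have -> : (fun p => col 0 (frame (w p) (b p))) = (fun p : S => colq 1 0).
    by apply/funext => p; apply/colP => i; rewrite !mxE.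
  apply: cw_parallel_colq.
  - by move=> u uS k; exact: Ck_on_cst.
  - by move=> u uS k; exact: Ck_on_cst.
  move=> u z X uS uz /=.
  rewrite !(mulr0, mul0r, oppr0, addr0, scaler0).
  by split; exact: derive_cst.
have -> : (fun p => col 1 (frame (w p) (b p))) = (fun p => colq (w p) (b p)).
  by apply/funext => p; apply/colP => i; rewrite !mxE.
exact: cw_parallel_member.
Qed.

End Member.
End AssociatedFamily.

(** * Convergence of the members to the Sym-Bobenko surface *)

Section Limit.
Variables (R : realType) (S : topologicalType) (atS : set (chart R S)).
Variables (s e : R) (alphat : R -> S -> quat R) (c0 : R).

Hypothesis rS : riemann_surface atS.
Hypothesis e0 : 0 < e.
Hypothesis sG : forall u, atS u -> smooth_on (`]s - e, s + e[ `*` cimg u)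
  (fun tz : R * (R * R) => alphat tz.1 (cinv u tz.2)).
Hypothesis c00 : c0 != 0.
Hypothesis nrm : forall p, qnorm2 (alphat s p) = c0.

(** Each coordinate r of alpha^-1 satisfies r^2 <= c0^-1. The cruder bound |r| <= 1 + c0^-1 avoids a
    square root and suffices, being uniform in p. *)
Lemma inv_norm_le p : `|(alphat s p)^-1| <= 1 + c0^-1.
Proof.
have c0p : 0 < c0.
  by rewrite lt_neqAle eq_sym c00 -(nrm p) /qnorm2 !addr_ge0 ?sqr_ge0.
have ci : 0 <= c0^-1 by rewrite invr_ge0 ltW.
have nP : qnorm2 (alphat s p)^-1 = c0^-1.
  have a0 : alphat s p != 0 by rewrite -qnorm2_eq0 nrm.
  have := congr1 (@qnorm2 R) (qmulV a0); rewrite qnorm2M nrm => E.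
  have n1 : qnorm2 (1 : quat R) = 1 by rewrite /qnorm2 !qco1; ring.
  by rewrite -[LHS](mulKf c00) E n1 mulr1.
move: ((alphat s p)^-1) (c0^-1) ci nP => x c c_ge0; rewrite /qnorm2 => xc.
have h0 := sqr_ge0 (qco x 0); have h1 := sqr_ge0 (qco x 1).
have h2 := sqr_ge0 (qco x 2); have h3 := sqr_ge0 (qco x 3).
have bnd (r : R) : r ^+ 2 <= c -> `|r| <= 1 + c.
  by move=> rc; rewrite ler_norml; apply/andP; split; nra.
by apply: quat_norm_le; rewrite ?addr_ge0 //; apply: bnd; lra.
Qed.

Lemma member_cvg (p : S) (d : R) : 0 < d ->
  \forall q \near p & l \near circle_to_1 R,
    `|sym_bobenko s alphat q - member s alphat (angle l) q| <= d.
Proof.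
move=> d0; have [u uS up] := rs_cover rS p.
have [_ ou K _ _] := rs_chart rS uS.
have [k k0 kM] := bilinear_schwarz (f := qmulB R) (@qmul_continuous R).
(* The error is -2 alpha^-1 times that of the difference quotient: 2 is the outer factor, k bounds
   the product in the sup norm, and 1 + c0^-1 bounds alpha^-1. *)
pose m := 2 * k * (1 + c0^-1).
have m0 : 0 < m.
  have c0p : 0 < c0.
    by rewrite lt_neqAle eq_sym c00 -(nrm p) /qnorm2 !addr_ge0 ?sqr_ge0.
  by rewrite !mulr_gt0 // addr_gt0 // invr_gt0.
have pz : cimg u (cmap u p) by exists p.
have dm : 0 < d / m by rewrite divr_gt0.
have [[Qz Qt] [/= nz nt] QQ] := difference_quotient (open_slab (s := s) (e := e) ou)
  (conj (slice_center s e0) pz) (sG uS) dm.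
have nq : \forall q \near p, exists2 z, Qz z & q = cinv u z.
  by apply: (chart_near rS uS up); apply: filterS nz => z Qz'; exists z.
exists ([set q | exists2 z, Qz z & q = cinv u z], [set l | Qt (angle l)]).
  by split => //=; exact: (angle_dnbhs nt).
move=> [_ l] /= [[z Qzz ->] Qtl]; have := QQ (z, angle l) (conj Qzz Qtl).
rewrite /= => bnd.
set a := alphat s (cinv u z).
have a0 : a != 0 by rewrite -qnorm2_eq0 nrm.
have -> : sym_bobenko s alphat (cinv u z) - member s alphat (angle l) (cinv u z) =
  - 2 *: (a^-1 * ('D_(1, 0) (fun tz : R * (R * R) => alphat tz.1 (cinv u tz.2)) (s, z) -
    (angle l)^-1 *: (alphat (s + angle l) (cinv u z) - a))).
  rewrite /sym_bobenko /member /deformation -/a derive1E.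
  rewrite (derive_slice1 (fun tz : R * (R * R) => alphat tz.1 (cinv u tz.2))).
  by rewrite [in RHS]mulrBr [in RHS]scalerBr qscaler mulrBr qmulVl // scalerA.
have dE : 2 * (k * (1 + c0^-1) * (d / m)) = d.
  by rewrite mulrA [2 * _]mulrA -/m mulrC divfK // lt0r_neq0.
rewrite normrZ normrN ger0_norm // -[leRHS]dE ler_pM2l //.
apply: le_trans (kM _ _) _.
rewrite ler_pM ?mulr_ge0 ?normr_ge0 ?(ltW k0) //.
by rewrite ler_pM2l //; exact: inv_norm_le.
Qed.

End Limit.

Theorem theorem5p4 (R : realType) (M Mt : topologicalType)
  (atM : set (chart R M)) (atMt : set (chart R Mt)) (pi : Mt -> M)
  (f N : M -> quat R) (s : R) (mu : quat R)
  (alpha : Mt -> quat R) (alphat : R -> Mt -> quat R) :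
  riemann_surface atM ->
  universal_cover atMt atM pi ->
  cmc_surface atM f N ->
  ~ in_round_sphere f ->
  mu = qexpi s ->
  cmc_parallel atMt (f \o pi) (N \o pi) mu alpha ->
  (exists p, alpha p != 0) ->
  parallel_family atMt (f \o pi) (N \o pi) s alphat ->
  alphat s = alpha ->
  let fa := sym_bobenko s alphat in
  let Na := sym_bobenko_gauss (N \o pi) alpha in
  exists (Phi : quat R -> Mt -> 'M[quat R]_2) (A : quat R -> Mt -> quat R),
    (\forall l \near circle_to_1 R, cw_associated atMt fa Na l (Phi l) (A l)) /\
    {family compact, A @ circle_to_1 R --> fa}.
Proof.
move=> rM [rS _ [cpi _ _] hpi] cmc _ _ _ [p0 ap0] [e e0 [sG par]] aE; subst alpha.
have im u z X (uS : atMt u) (uz : cimg u z) : qco (dform u (f \o pi) z X) 0 = 0.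
  by have [] := pullback_gauss rM rS cpi hpi cmc X uS uz.
have anti u z X (uS : atMt u) (uz : cimg u z) : dform u (f \o pi) z X * (N \o pi) (cinv u z) =
    - ((N \o pi) (cinv u z) * dform u (f \o pi) z X).
  by have [] := pullback_gauss rM rS cpi hpi cmc X uS uz.
pose c0 := qnorm2 (alphat s p0).
have c00 : c0 != 0 by rewrite qnorm2_eq0.
have nrm p : qnorm2 (alphat s p) = c0.
  exact: (parallel_norm rS im anti (par s (slice_center s e0)) p0 p).
(* Continuity in t gives alpha(t) != 0 at the single point p0 for t near s; constancy of the norm
   spreads this to the whole cover for the same t. *)
have nz : \forall t \near s, (t \in `]s - e, s + e[) /\ forall p, alphat t p != 0.
  have [u uS up] := rs_cover rS p0; have [_ ou K _ _] := rs_chart rS uS.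
  have nI : \forall t \near s, `]s - e, s + e[%classic t.
    by apply: open_nbhs_nbhs; split; [exact: interval_open|exact: slice_center].
  have n0 : \forall t \near s, alphat t p0 != 0.
    have pz : cimg u (cmap u p0) by exists p0.
    have c : {for s, continuous (fun t : R => alphat t (cinv u (cmap u p0)))}.
      have c1 : {for s, continuous (fun t : R => (t, cmap u p0) : R * (R * R))}.
        by apply: differentiable_continuous; exact: differentiable_pair.
      apply: (@continuous_comp _ _ _ (fun t : R => (t, cmap u p0) : R * (R * R))
        (fun tz : R * (R * R) => alphat tz.1 (cinv u tz.2)) s c1).
      by apply: (smooth_on_continuous (sG u uS)); split => //=; exact: slice_center.
    rewrite K // in c; apply: (c [set x | x != 0]).
    apply: open_nbhs_nbhs; split; last exact: ap0.
    have -> : [set x : quat R | x != 0] = ~` [set 0].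
      by apply/funext => x; apply/propext; split=> [/eqP //|x0]; exact/eqP.
    apply: closed_openC; apply: accessible_closed_set1.
    exact/hausdorff_accessible/norm_hausdorff.
  near=> t; have It : t \in `]s - e, s + e[ by near: t.
  split=> // p; rewrite -qnorm2_eq0 (parallel_norm rS im anti (par t It) p0 p) qnorm2_eq0.
  by near: t.
have nl : \forall l \near circle_to_1 R, (s + angle l \in `]s - e, s + e[) /\
    forall p, alphat (s + angle l) p != 0.
  have n0 : \forall t \near 0^', (s + t \in `]s - e, s + e[) /\ forall p, alphat (s + t) p != 0.
    apply: nbhs_dnbhs; move: nz; rewrite (near_shift 0) /= subr0.
    by apply: filterS => t /=; rewrite addrC.
  exact: (angle_dnbhs n0).
move=> fa Na.
(* Defined for every quaternion l, but a parallel frame and its surface only for l near 1 on the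
   punctured circle. *)
pose A l := member s alphat (angle l).
pose b l p := (angle l)^-1 *: deformation_dual pi N s alphat (angle l) p.
exists (fun l p => frame (fa p * b l p - A l p) (b l p)), A; split.
  apply: filterS (filterI nl (circle_to_1_angle R)) => l [[It az] [lE c1]].
  rewrite {1}lE.
  exact: (cw_associated_member rM rS cpi hpi cmc e0 sG par c00 nrm It c1 az).
apply: family_compact_cvg => p d d0.
exact: (member_cvg rS e0 sG c00 nrm p d0).
Unshelve. all: by end_near. Qed.
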